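(* Let $(R,\mathfrak{m})$ be an LC-finite regular local ring with $\dim R\leq 7$, and let $p=\operatorname{char}(R/\mathfrak{m})$. Let $I\supset J$ be ideals of $R$. Suppose that each of $I$ and $J$ is generated by a part of a regular system of parameters of $R$. If either $p\in J$ or $p\notin\mathfrak{m}^2+J$, then $\operatorname{Ass} H_I^i(J)$ is finite for any $i\geq 0$.
   Context: All rings are commutative with identity. $H_I^i(M)$ denotes the $i$-th local cohomology module of $M$ with respect to $I$, and $\operatorname{Ass} M$ is the set of associated primes of $M$. A Noetherian ring $R$ is called LC-finite if $\operatorname{Ass} H_{\mathfrak a}^i(R)$ is finite for every ideal $\mathfrak a$ of $R$ and every $i\geq 0$. A regular system of parameters of an $r$-dimensional regular local ring $(R,\mathfrak m)$ is a set of $r$ elements generating $\mathfrak m$. The integer $p$ is identified with its image in $R$. The notation $I\supset J$ means containment, not necessarily strict. *)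

(* Defs.v *)
From HB Require Import structures.
From mathcomp Require Import all_boot all_order all_algebra generic_quotient.
From mathcomp Require Import all_classical.

Set Implicit Arguments.
Unset Strict Implicit.
Unset Printing Implicit Defensive.

Import GRing.Theory.

Local Open Scope classical_set_scope.
Local Open Scope quotient_scope.
Local Open Scope ring_scope.

Definition is_submodule (R : comNzRingType) (M : lmodType R) (N : set M) : Prop :=
  N 0 /\ forall (a : R) (u v : M), N u -> N v -> N (a *: u + v).

Record submodule (R : comNzRingType) (M : lmodType R) := Submodule {
  submodule_set :> set M;
  submoduleP : is_submodule submodule_set }.

Definition span (R : comNzRingType) (M : lmodType R) (S : set M) : set M :=
  smallest (@is_submodule R M) S.

Section SubmoduleType.
Variables (R : comNzRingType) (M : lmodType R) (N : submodule M).

Definition submod_type : Type := {x : M | x \in (N : set M)}.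

HB.instance Definition _ := SubChoice.copy submod_type {x : M | x \in (N : set M)}.

Lemma submod_type_closed :
  GRing.subsemimod_closed (fun x : M => x \in (N : set M)).
Proof.
have [N0 NL] := submoduleP N.
split; first split; rewrite ?inE //.
- move=> x y /set_mem Nx /set_mem Ny; apply/mem_set.
  by rewrite -[x]scale1r; apply: NL.
- move=> a x /set_mem Nx; apply/mem_set.
  by rewrite -[a *: x]addr0; apply: NL.
Qed.

HB.instance Definition _ :=
  GRing.SubChoice_isSubLmodule.Build R M _ submod_type submod_type_closed.

End SubmoduleType.

Section QuotientModule.
Variables (R : comNzRingType) (M : lmodType R) (N : submodule M).

Definition quot_rel (x y : M) : bool := `[< submodule_set N (x - y) >].

Lemma quot_rel_equiv : equiv_class_of quot_rel.
Proof.
have [N0 NL] := submoduleP N.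
have NN x : submodule_set N x -> submodule_set N (- x) by move=> Nx; rewrite -[- x]addr0 -scaleN1r; apply: NL.
have ND x y : submodule_set N x -> submodule_set N y -> submodule_set N (x + y).
  by move=> Nx Ny; rewrite -[x]scale1r; apply: NL.
split=> [x|x y|y x z].
- by apply/asboolP; rewrite subrr.
- by apply/asboolP/asboolP => /NN; rewrite opprB.
- move=> /asboolP xy /asboolP yz; apply/asboolP.
  by rewrite -(subrKA y); apply: ND.
Qed.

Canonical quot_equiv_rel := EquivRelPack quot_rel_equiv.

Definition quot_mod := {eq_quot quot_rel}.

HB.instance Definition _ : EqQuotient M quot_rel quot_mod :=
  EqQuotient.on quot_mod.
HB.instance Definition _ := Choice.on quot_mod.

Definition quot_zero : quot_mod := \pi_quot_mod 0.
Definition quot_opp (x : quot_mod) : quot_mod := \pi_quot_mod (- repr x).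
Definition quot_add (x y : quot_mod) : quot_mod :=
  \pi_quot_mod (repr x + repr y).
Definition quot_scale (a : R) (x : quot_mod) : quot_mod :=
  \pi_quot_mod (a *: repr x).

Lemma quot_eqP (x y : M) :
  \pi_quot_mod x = \pi_quot_mod y <-> submodule_set N (x - y).
Proof.
by split=> [/eqmodP/asboolP//|xy]; apply/eqmodP/asboolP.
Qed.

Lemma quot_reprK (x : M) : submodule_set N (repr (\pi_quot_mod x) - x).
Proof. by apply/quot_eqP; rewrite reprK. Qed.

Lemma quot_oppE x : quot_opp (\pi_quot_mod x) = \pi_quot_mod (- x).
Proof.
have [N0 NL] := submoduleP N; apply/quot_eqP.
by rewrite -opprD -[X in submodule_set N X]addr0 -[X in submodule_set N (X + _)]scaleN1r; apply: NL => //; apply: quot_reprK.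
Qed.

Lemma quot_addE x y :
  quot_add (\pi_quot_mod x) (\pi_quot_mod y) = \pi_quot_mod (x + y).
Proof.
have [N0 NL] := submoduleP N; apply/quot_eqP.
rewrite opprD addrACA -[X in submodule_set N (X + _)]scale1r.
by apply: NL; apply: quot_reprK.
Qed.

Lemma quot_scaleE a x :
  quot_scale a (\pi_quot_mod x) = \pi_quot_mod (a *: x).
Proof.
have [N0 NL] := submoduleP N; apply/quot_eqP.
by rewrite -scalerBr -[_ *: _]addr0; apply: NL => //; apply: quot_reprK.
Qed.

Lemma quot_ind (P : quot_mod -> Prop) :
  (forall x : M, P (\pi_quot_mod x)) -> forall x, P x.
Proof. by move=> Ppi x; rewrite -[x]reprK. Qed.

Lemma quot_addA : associative quot_add.
Proof.
by elim/quot_ind=> x; elim/quot_ind=> y; elim/quot_ind=> z; rewrite !quot_addE addrA.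
Qed.

Lemma quot_addC : commutative quot_add.
Proof. by elim/quot_ind=> x; elim/quot_ind=> y; rewrite !quot_addE addrC. Qed.

Lemma quot_add0 : left_id quot_zero quot_add.
Proof. by elim/quot_ind=> x; rewrite quot_addE add0r. Qed.

Lemma quot_addN : left_inverse quot_zero quot_opp quot_add.
Proof. by elim/quot_ind=> x; rewrite quot_oppE quot_addE addNr. Qed.

HB.instance Definition _ :=
  GRing.isZmodule.Build quot_mod quot_addA quot_addC quot_add0 quot_addN.

Lemma quot_scaleA a b x : quot_scale a (quot_scale b x) = quot_scale (a * b) x.
Proof. by elim/quot_ind: x => x; rewrite !quot_scaleE scalerA. Qed.

Lemma quot_scale1 : left_id 1 quot_scale.
Proof. by elim/quot_ind=> x; rewrite quot_scaleE scale1r. Qed.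

Lemma quot_scaleDr : right_distributive quot_scale quot_add.
Proof.
move=> a; elim/quot_ind=> x; elim/quot_ind=> y.
by rewrite !(quot_addE, quot_scaleE) scalerDr.
Qed.

Lemma quot_scaleDl x : {morph quot_scale^~ x : a b / a + b >-> quot_add a b}.
Proof.
by move=> a b; elim/quot_ind: x => x; rewrite !(quot_addE, quot_scaleE) scalerDl.
Qed.

HB.instance Definition _ := GRing.Zmodule_isLmodule.Build R quot_mod
  quot_scaleA quot_scale1 quot_scaleDr quot_scaleDl.

End QuotientModule.

(* Ideals are the submodules of R^o, so they are R-modules via [submod_type].  *)
Definition is_ideal (R : comNzRingType) (a : set R) : Prop :=
  @is_submodule R R^o a.

Definition ideal (R : comNzRingType) : Type := @submodule R R^o.

Definition ideal_span (R : comNzRingType) (S : set R) : set R :=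
  @span R R^o S.

Definition ideal_add (R : comNzRingType) (a b : set R) : set R :=
  [set x + y | x in a & y in b].

Definition ideal_mul (R : comNzRingType) (a b : set R) : set R :=
  ideal_span [set x * y | x in a & y in b].

Definition ideal_exp (R : comNzRingType) (a : set R) (n : nat) : set R :=
  iter n (ideal_mul a) setT.

Definition prime_ideal (R : comNzRingType) (P : set R) : Prop :=
  [/\ is_ideal P, ~ P 1 & forall x y : R, P (x * y) -> P x \/ P y].

Definition maximal_ideal (R : comNzRingType) (m : set R) : Prop :=
  [/\ is_ideal m, ~ m 1 &
      forall a : set R, is_ideal a -> ~ a 1 -> m `<=` a -> a = m].

Definition noetherian (R : comNzRingType) : Prop :=
  forall a : set R, is_ideal a ->
    exists2 S : set R, finite_set S & ideal_span S = a.

Definition local_ring (R : comNzRingType) (m : set R) : Prop :=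
  maximal_ideal m /\ forall n : set R, maximal_ideal n -> n = m.

Definition prime_chain (R : comNzRingType) (P : nat -> set R) (r : nat) : Prop :=
  (forall i, (i <= r)%N -> prime_ideal (P i)) /\
  (forall i, (i < r)%N -> P i `<` P i.+1).

Definition krull_dim (R : comNzRingType) (r : nat) : Prop :=
  (exists P : nat -> set R, prime_chain P r) /\
  forall (P : nat -> set R) (s : nat), prime_chain P s -> (s <= r)%N.

(* Meant for r = dim R, which [regular_local_ring] imposes.                   *)
Definition regular_system (R : comNzRingType) (m : set R) (r : nat)
    (S : set R) : Prop :=
  (S #= `I_r)%card /\ ideal_span S = m.

Definition regular_local_ring (R : comNzRingType) (m : set R) (r : nat) : Prop :=
  [/\ noetherian R, local_ring m, krull_dim R r &
      exists S : set R, regular_system m r S].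

Definition generated_by_part_of_regular_system (R : comNzRingType) (m : set R)
    (r : nat) (a : set R) : Prop :=
  exists S T : set R,
    [/\ regular_system m r S, T `<=` S & ideal_span T = a].

(* p generates the kernel of the canonical map from the integers to R / m.    *)
Definition residue_char (R : comNzRingType) (m : set R) (p : nat) : Prop :=
  forall n : nat, m n%:R <-> (p %| n)%N.

Definition Ass (R : comNzRingType) (M : lmodType R) : set (set R) :=
  [set P | prime_ideal P /\ exists x : M, P = [set a : R | a *: x = 0]].

Definition injective_module (R : comNzRingType) (E : lmodType R) : Prop :=
  forall (A B : lmodType R) (f : {linear A -> B}) (g : {linear A -> E}),
    injective f -> exists h : {linear B -> E}, forall x : A, h (f x) = g x.

Record injective_resolution (R : comNzRingType) (M : lmodType R) :=
  InjectiveResolution {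
    res_obj : nat -> lmodType R;
    res_aug : {linear M -> res_obj 0};
    res_diff : forall n, {linear res_obj n -> res_obj n.+1};
    res_injective : forall n, injective_module (res_obj n);
    res_aug_inj : injective res_aug;
    res_aug_exact : forall x : res_obj 0,
      res_diff 0 x = 0 <-> exists y : M, res_aug y = x;
    res_exact : forall n (x : res_obj n.+1),
      res_diff n.+1 x = 0 <-> exists y : res_obj n, res_diff n y = x }.

Definition torsion (R : comNzRingType) (I : ideal R) (M : lmodType R) : set M :=
  [set x | exists n : nat, forall a : R, ideal_exp I n a -> a *: x = 0].

Lemma ideal_exp_ideal (R : comNzRingType) (I : set R) (n : nat) :
  is_ideal (ideal_exp I n).
Proof.
case: n => [|n]; first by split.
split=> [N [[N0 NL] _]//|a u v Iu Iv N CN].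
by case: (CN) => -[_ NL] _; apply: NL; [apply: Iu | apply: Iv].
Qed.

Lemma ideal_exp_le (R : comNzRingType) (I : set R) (m n : nat) :
  (m <= n)%N -> ideal_exp I n `<=` ideal_exp I m.
Proof.
elim: n => [|n IHn]; first by rewrite leqn0 => /eqP->.
rewrite leq_eqVlt => /predU1P[->//|/IHn le_mn]; apply: subset_trans le_mn.
apply: smallest_sub; first exact: ideal_exp_ideal.
move=> _ [x _ [y Iy <-]]; have [I0 IL] := ideal_exp_ideal I n.
by rewrite -[x * y]addr0; apply: IL.
Qed.

Lemma torsion_submodule (R : comNzRingType) (I : ideal R) (M : lmodType R) :
  is_submodule (@torsion R I M).
Proof.
split=> [|a u v [n nu] [k kv]]; first by exists 0%N => b _; rewrite scaler0.
exists (maxn n k) => b Ib; rewrite scalerDr scalerA mulrC -scalerA.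
rewrite nu ?kv ?scaler0 ?addr0 //; apply: ideal_exp_le Ib.
  exact: leq_maxr.
exact: leq_maxl.
Qed.

(* The i-th cohomology of the complex of I-torsion submodules                 *)
(*   0 -> torsion I E^0 -> torsion I E^1 -> ...                               *)
Section LocalCohomology.
Variables (R : comNzRingType) (I : ideal R) (M : lmodType R).
Variables (E : injective_resolution M) (i : nat).

Definition lc_cocycle_set : set (res_obj E i) :=
  [set x | torsion I x /\ res_diff E i x = 0].

Lemma lc_cocycleP : is_submodule lc_cocycle_set.
Proof.
have [T0 TL] := torsion_submodule I (res_obj E i).
split=> [|a u v [Tu du] [Tv dv]]; first by split=> //; rewrite linear0.
by split; [apply: TL | rewrite linearP du dv scaler0 addr0].
Qed.

Definition lc_cocycle : submodule (res_obj E i) := Submodule lc_cocycleP.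

Definition lc_coboundary_set : set (res_obj E i) :=
  match i return set (res_obj E i) with
  | 0 => [set 0]
  | j.+1 => [set res_diff E j y | y in @torsion R I (res_obj E j)]
  end.

Lemma lc_coboundaryP :
  is_submodule [set z : submod_type lc_cocycle | lc_coboundary_set (\val z)].
Proof.
rewrite /is_submodule /=; split=> [|a u v]; rewrite ?linear0 ?linearP.
  rewrite /lc_coboundary_set; case: (i) => [//|j].
  have [T0 _] := torsion_submodule I (res_obj E j).
  by exists 0 => //; rewrite linear0.
move: (\val u) (\val v); rewrite /lc_coboundary_set; case: (i) => [|j] x y.
  by move=> -> ->; rewrite scaler0 addr0.
have [_ TL] := torsion_submodule I (res_obj E j).
by move=> [x' Tx <-] [y' Ty <-]; exists (a *: x' + y'); [apply: TL|rewrite linearP].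
Qed.

Definition lc_coboundary : submodule (submod_type lc_cocycle) :=
  Submodule lc_coboundaryP.

Definition local_cohomology : lmodType R := quot_mod lc_coboundary.

End LocalCohomology.

Arguments local_cohomology {R} I {M} E i.

(* H^i_I(M) is the i-th right derived functor of I-torsion; up to isomorphism *)
(* it does not depend on the injective resolution, and neither does its set   *)
(* of associated primes. As no resolution is singled out, finiteness is       *)
(* required for every one of them.                                            *)
Definition lc_Ass_finite (R : comNzRingType) (I : ideal R) (M : lmodType R)
    (i : nat) : Prop :=
  forall E : injective_resolution M, finite_set (Ass (local_cohomology I E i)).

Definition LC_finite (R : comNzRingType) : Prop :=
  noetherian R /\
  forall (a : ideal R) (i : nat), lc_Ass_finite a R^o i.

(* Main.v *)
(* Every element a outside I acts injectively on every H^i_I(J). An associated *)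
(* prime of an I-torsion module contains I, so I is then the only possible     *)
(* associated prime of H^i_I(J).                                               *)
(*                                                                             *)
(* By exchange, I and J have generators x_1..x_j, y_1..y_k and x_1..x_j that   *)
(* form the beginning of one regular system of parameters, hence a regular     *)
(* sequence, which stays regular after appending a because I is prime. Write   *)
(* C_l for the l-torsion of an injective resolution of J. Adding one generator *)
(* x to l gives a short exact sequence                                         *)
(*   0 -> H^1_x(H^(i-1)(C_l)) -> H^i(C_(l,x)) -> H^0_x(H^i(C_l)) -> 0,         *)
(* and H^1_x(N) = N_x/N is the direct limit of the N/x^n N, so regular         *)
(* sequences (x, s) on all the H^i(C_l) turn into regular sequences s on the   *)
(* H^i(C_(l,x)). For j <= 1 the module J is zero or free and this settles the  *)
(* matter. For j >= 2, after x_1 and x_2 the cohomology is R/J in degree 1 and *)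
(* the direct limit of the R/(x_1^n, x_2^n) in degree 2; the generators        *)
(* x_3..x_j leave the former unchanged, and y_1..y_k, a is regular on it.      *)

From HB Require Import structures.
Require Import Defs.
From mathcomp Require Import all_boot all_algebra generic_quotient.
From mathcomp Require Import all_classical.
From mathcomp Require Import ring zify.

Set Implicit Arguments.
Unset Strict Implicit.
Unset Printing Implicit Defensive.

Import GRing.Theory.
Local Open Scope classical_set_scope.
Local Open Scope ring_scope.

(** * Subquotients and regular sequences *)

(** Cohomology is handled through pairs: the [cocycles] Z and [coboundaries] B of the l-torsion of a
    resolution, with [regseq Z B s] for regularity on Z/B. The induction on generators is
    [regseq_cocycles_cons]: if x is regular on every H^i, then [connecting_colimit] presents the
    next cohomology as the limit of the N/x^n N, N being the cohomology one degree lower;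
    [regseq_exp] passes from N/xN to N/x^n N, and [colimit_regseq] to the limit.

    This induction breaks down at x_2 when J has two or more generators, because J_(x_1)/J has
    x_2-torsion. But J and R agree after inverting x_1 or x_2, which gives R/J in degree 1
    ([colimit_H1]) and the limit of the R/(x_1^n, x_2^n) in degree 2 ([colimit_H2]);
    [regseq_two_steps] starts again from there.

    Regular sequences come from [primeseq_chain]: a chain of primes as long as a list of generators
    of m forces all partial ideals to be prime. [exchange] aligns the generators of J and I, and
    [Ass_local_cohomology] turns regularity into the bound on associated primes. *)

Section Submodules.
Variables (R : comNzRingType) (M : lmodType R).
Implicit Types (A B Z : set M) (x y a : R) (s : seq R).

Lemma subm0 A : is_submodule A -> A 0. Proof. by case. Qed.

Lemma submD A u v : is_submodule A -> A u -> A v -> A (u + v).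
Proof. by move=> [_ AL] Au Av; rewrite -[u]scale1r; apply: AL. Qed.

Lemma submZ A a u : is_submodule A -> A u -> A (a *: u).
Proof. by move=> [A0 AL] Au; rewrite -[a *: u]addr0; apply: AL. Qed.

Lemma submN A u : is_submodule A -> A u -> A (- u).
Proof. by move=> hA Au; rewrite -scaleN1r; apply: submZ. Qed.

Lemma submB A u v : is_submodule A -> A u -> A v -> A (u - v).
Proof. by move=> hA Au Av; apply: submD => //; apply: submN. Qed.

Lemma subm_zero : is_submodule [set 0 : M].
Proof. by split=> // a u v -> ->; rewrite scaler0 addr0. Qed.

Lemma subm_setT : is_submodule [set: M]. Proof. by []. Qed.

Lemma span_subm (S : set M) : is_submodule (Defs.span S).
Proof.
split=> [N [[N0 _] _] //|a u v Su Sv N NS].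
by case: (NS) => -[_ NL] _; apply: NL; [apply: Su|apply: Sv].
Qed.

Lemma span_le (S A : set M) : is_submodule A -> S `<=` A -> Defs.span S `<=` A.
Proof. by move=> hA SA; apply: smallest_sub. Qed.

Definition addx B Z x : set M := [set b + x *: z | b in B & z in Z].

Lemma addx_subm B Z x : is_submodule B -> is_submodule Z ->
  is_submodule (addx B Z x).
Proof.
move=> hB hZ; split.
  by exists 0; [exact: subm0|exists 0; [exact: subm0|rewrite scaler0 addr0]].
move=> a _ _ [b1 Bb1 [z1 Zz1 <-]] [b2 Bb2 [z2 Zz2 <-]].
exists (a *: b1 + b2); first by apply: submD => //; apply: submZ.
exists (a *: z1 + z2); first by apply: submD => //; apply: submZ.
by rewrite !scalerDr !scalerA [x * a]mulrC addrACA.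
Qed.

Lemma addxl B Z x : is_submodule Z -> B `<=` addx B Z x.
Proof. by move=> hZ b Bb; exists b => //; exists 0; [exact: subm0|rewrite scaler0 addr0]. Qed.

Lemma addxr B Z x z : is_submodule B -> Z z -> addx B Z x (x *: z).
Proof. by move=> hB Zz; exists 0; [exact: subm0|exists z; rewrite ?add0r]. Qed.

Lemma addx_le B Z A x : is_submodule A -> B `<=` A ->
  (forall z, Z z -> A (x *: z)) -> addx B Z x `<=` A.
Proof.
by move=> hA BA ZA _ [b Bb [z Zz <-]]; apply: submD => //; [apply: BA|apply: ZA].
Qed.

Lemma addxAC B Z x y : addx (addx B Z x) Z y = addx (addx B Z y) Z x.
Proof.
have H u v w : addx (addx B Z u) Z v w -> addx (addx B Z v) Z u w.
  move=> [_ [b Bb [z Zz <-]] [t Zt <-]].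
  by exists (b + v *: t); [exists b => //; exists t|exists z; rewrite // addrAC].
by apply/seteqP; split=> w; apply: H.
Qed.

Lemma addxP B Z x w : addx B Z x w <-> exists2 z, Z z & B (w - x *: z).
Proof.
split=> [[b Bb [z Zz <-]]|[z Zz Bz]]; first by exists z; rewrite ?addrK.
by exists (w - x *: z) => //; exists z; rewrite ?subrK.
Qed.

(* [regseq Z B s]: [s] is a weakly regular sequence on the quotient Z/B. *)
Fixpoint regseq Z B s : Prop :=
  if s is x :: s' then
    (forall z, Z z -> B (x *: z) -> B z) /\ regseq Z (addx B Z x) s'
  else True.

Lemma regseq_trivial Z B s : is_submodule Z -> Z `<=` B -> regseq Z B s.
Proof.
move=> hZ; elim: s B => [//|x s IH] B ZB; split; first by move=> z /ZB.
by apply: IH; apply: subset_trans ZB _; apply: addxl.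
Qed.

(** For a regular sequence x, y, the element x stays regular modulo y, so the induction on [s]
    continues over [addx B Z y]; and y is regular modulo x^n by induction on n. *)
Lemma regseq_exp Z B x s n : is_submodule Z -> is_submodule B ->
  (forall z, Z z -> B (x *: z) -> B z) -> regseq Z (addx B Z x) s ->
  regseq Z (addx B Z (x ^+ n)) s.
Proof.
move=> hZ; elim: s B => [//|y s IH] B hB regx [regy regs]; split; last first.
  rewrite addxAC; apply: IH; first exact: addx_subm.
    move=> z Zz /addxP[w Zw Bw].
    have /regy-/(_ Zw) : addx B Z x (y *: w).
      apply/addxP; exists z => //.
      by rewrite -opprB; apply: submN.
    move=> /addxP[t Zt Bt]; apply/addxP; exists t => //; apply: regx.
      by apply: submB => //; apply: submZ.
    rewrite scalerBr scalerA [x * y]mulrC.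
    have -> : x *: z - (y * x) *: t = x *: z - y *: w + y *: (w - x *: t).
      by rewrite scalerBr scalerA addrA subrK.
    by apply: submD => //; apply: submZ.
  by rewrite addxAC.
elim: n {IH} => [|n IHn] z Zz /addxP[c Zc Bc].
  by apply/addxP; exists z => //; rewrite expr0 scale1r subrr; apply: subm0.
(* Modulo B, z is x w; cancelling x reduces the claim for z and n + 1 to the claim for w and n. *)
have /regy-/(_ Zz) : addx B Z x (y *: z).
  apply/addxP; exists (x ^+ n *: c); first exact: submZ.
  by rewrite scalerA -exprS.
move=> /addxP[w Zw Bw].
have /IHn-/(_ Zw) : addx B Z (x ^+ n) (y *: w).
  apply/addxP; exists c => //; apply: regx.
    by apply: submB => //; apply: submZ.
  rewrite scalerBr !scalerA -exprS.
  have -> : (x * y) *: w - x ^+ n.+1 *: c =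
            (y *: z - x ^+ n.+1 *: c) - y *: (z - x *: w).
    by rewrite scalerBr scalerA [y * x]mulrC opprB [RHS]addrC addrA subrK.
  by apply: submB => //; apply: submZ.
move=> /addxP[t Zt Bt]; apply/addxP; exists t => //.
have -> : z - x ^+ n.+1 *: t = (z - x *: w) + x *: (w - x ^+ n *: t).
  by rewrite scalerBr scalerA -exprS addrA subrK.
by apply: submD => //; apply: submZ.
Qed.

Definition lin Z B s : set M := foldl (fun A x => addx A Z x) B s.

Lemma lin_subm Z B s : is_submodule Z -> is_submodule B ->
  is_submodule (lin Z B s).
Proof. by move=> hZ; elim: s B => [//|x s IH] B hB; apply: IH; apply: addx_subm. Qed.

Lemma lin_cons Z B x s : lin Z B (x :: s) = addx (lin Z B s) Z x.
Proof.
rewrite /lin /=; elim: s B => [//|y s IH] B /=.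
by rewrite -IH; congr foldl; rewrite addxAC.
Qed.

Lemma lin_cat Z B s t : lin Z B (s ++ t) = lin Z (lin Z B s) t.
Proof. by rewrite /lin foldl_cat. Qed.

Lemma sub_lin Z B s : is_submodule Z -> B `<=` lin Z B s.
Proof.
by move=> hZ; elim: s => [//|x s IH]; rewrite lin_cons; apply: subset_trans IH _; apply: addxl.
Qed.

Lemma mem_lin Z B s x z : is_submodule Z -> is_submodule B -> x \in s -> Z z ->
  lin Z B s (x *: z).
Proof.
move=> hZ hB; elim: s => [//|y s IH]; rewrite inE lin_cons => /predU1P[->|xs] Zz.
  by apply: addxr => //; apply: lin_subm.
by apply: addxl => //; apply: IH.
Qed.

Lemma lin_le Z B A s : is_submodule A -> B `<=` A ->
  (forall x z, x \in s -> Z z -> A (x *: z)) -> lin Z B s `<=` A.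
Proof.
move=> hA BA; elim: s => [//|y s IH] sA; rewrite lin_cons; apply: addx_le => //.
  by apply: IH => x z xs; apply: sA; rewrite inE xs orbT.
by move=> z; apply: sA; rewrite mem_head.
Qed.

Lemma eq_lin Z B s t : is_submodule Z -> is_submodule B -> s =i t ->
  lin Z B s = lin Z B t.
Proof.
move=> hZ hB st; apply/seteqP; split; apply: lin_le;
  do ?[exact: lin_subm | exact: sub_lin] => x z xs Zz.
  by apply: mem_lin; rewrite -?st.
by apply: mem_lin; rewrite ?st.
Qed.

End Submodules.

(** * Direct limits of subquotients *)

Section Colimits.
Variables (R : comNzRingType) (M M' : lmodType R).

(* The quotient Z'/B' is the direct limit of the quotients Z/(Bn n) along    *)
(* multiplication by v; [rho n z z'] means that z' represents the image of   *)
(* the class of z at the n-th stage.                                         *)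
Record colimit (Z : set M) (Bn : nat -> set M) (v : R) (Z' B' : set M')
    (rho : nat -> M -> M' -> Prop) : Prop := Colimit {
  colim_tot : forall n z, Z z -> exists2 z', Z' z' & rho n z z';
  colim_onto : forall z', Z' z' -> exists n, exists2 z, Z z & rho n z z';
  colim_lin : forall n a z w z' w', rho n z z' -> rho n w w' ->
    rho n (a *: z + w) (a *: z' + w');
  colim_up : forall n z z', rho n z z' -> rho n.+1 (v *: z) z';
  colim_ker : forall n z z', Z z -> Z' z' -> rho n z z' ->
    (B' z' <-> exists k, Bn (n + k)%N (v ^+ k *: z)) }.

Variables (Z : set M) (Bn : nat -> set M) (v : R) (Z' B' : set M').
Variable rho : nat -> M -> M' -> Prop.

Lemma colim_upk n k z z' : colimit Z Bn v Z' B' rho -> rho n z z' ->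
  rho (n + k)%N (v ^+ k *: z) z'.
Proof.
move=> H h; elim: k => [|k IH]; first by rewrite addn0 expr0 scale1r.
by rewrite addnS exprS -scalerA; apply: (colim_up H).
Qed.

Lemma colimB n z w z' w' : colimit Z Bn v Z' B' rho ->
  rho n z z' -> rho n w w' -> rho n (z - w) (z' - w').
Proof.
by move=> H hz hw; rewrite addrC -scaleN1r [z' - w']addrC -scaleN1r; apply: (colim_lin H).
Qed.

Lemma colimZ n a z z' : colimit Z Bn v Z' B' rho ->
  rho n z z' -> rho n (a *: z) (a *: z').
Proof.
by move=> H hz; have := colim_lin H a hz (colimB H hz hz); rewrite !subrr !addr0.
Qed.

Lemma colim_common n1 n2 z1 z2 z1' z2' : colimit Z Bn v Z' B' rho ->
  rho n1 z1 z1' -> rho n2 z2 z2' -> exists k1 k2,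
  [/\ (n1 + k1 = n2 + k2)%N, rho (n1 + k1)%N (v ^+ k1 *: z1) z1'
    & rho (n1 + k1)%N (v ^+ k2 *: z2) z2'].
Proof.
move=> H h1 h2; exists (n2)%N, n1%N; split; first exact: addnC.
  exact: colim_upk.
by rewrite addnC; apply: colim_upk.
Qed.

End Colimits.

(** Direct limits are exact, so injectivity of [y] at every stage passes to the limit. Reduction
    modulo [y] commutes with the limit: [rho] is kept while [Bn n] and [B'] grow. *)
Lemma colimit_regseq (R : comNzRingType) (M M' : lmodType R)
    (Z : set M) (Bn : nat -> set M) (v : R) (Z' B' : set M')
    (rho : nat -> M -> M' -> Prop) (s : seq R) :
  is_submodule Z -> (forall n, is_submodule (Bn n)) -> is_submodule Z' ->
  is_submodule B' ->
  colimit Z Bn v Z' B' rho -> (forall n, regseq Z (Bn n) s) -> regseq Z' B' s.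
Proof.
move=> hZ hB hZ'; elim: s Bn B' hB => [//|y s IH] Bn B' hB hB' H reg; split.
  move=> z' Zz' Bz'; have [n [z Zz zz']] := colim_onto H Zz'.
  have [||k] := iffLR (colim_ker H _ _ (colimZ y H zz')) Bz'; do ?exact: submZ.
  rewrite scalerA mulrC -scalerA => /(proj1 (reg _)) h.
  apply/(colim_ker H Zz Zz' zz'); exists k; apply: h; exact: submZ.
apply: (IH (fun n => addx (Bn n) Z y)); [|exact: addx_subm| |by move=> n; case: (reg n)].
  by move=> n; apply: addx_subm.
case: (H) => tot onto lin up ker; split=> // n z z' Zz Zz' zz'; split.
  move=> /addxP[w' Zw' Bw']; have [m [w Zw ww']] := onto _ Zw'.
  have [k1 [k2 [e h1 h2]]] := colim_common H zz' ww'.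
  have h := colimB H h1 (colimZ y H h2).
  have [||k] := iffLR (ker _ _ _ _ _ h) Bw'; do ?by apply: submB; do ?apply: submZ.
  rewrite -addnA => hk; exists (k1 + k)%N; apply/addxP; exists (v ^+ k *: (v ^+ k2 *: w)).
    by do ?apply: submZ.
  move: hk; congr (Bn _ _); rewrite scalerBr exprD !scalerA.
  by congr (_ *: _ - _ *: _); [rewrite mulrC|congr (_ * _); rewrite mulrC].
move=> [k /addxP[w Zw Bw]]; have [w' Zw' ww'] := tot (n + k)%N _ Zw.
apply/addxP; exists w' => //.
have h := colimB H (colim_upk k H zz') (colimZ y H ww').
apply: (iffRL (ker _ _ _ _ _ h)); do ?by apply: submB; do ?apply: submZ.
by exists 0%N; rewrite addn0 expr0 scale1r.
Qed.

(** * Ideals of a Noetherian ring *)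

Section Ideals.
Variable R : comNzRingType.
Implicit Types (A B F G P Q : set R^o) (s us : seq R).

Lemma scale_mulE (a : R) (u : R^o) : a *: u = a * u. Proof. by []. Qed.

Lemma idealMl A a u : is_submodule A -> A u -> A (a * u).
Proof. exact: (@submZ R R^o). Qed.

Lemma prime_subm P : prime_ideal P -> is_submodule P.
Proof. by case. Qed.

Lemma primeM P a (u : R^o) : prime_ideal P -> ~ P a -> P (a *: u) -> P u.
Proof. by move=> [_ _ hP] Pa /hP[/Pa|]. Qed.

Lemma prime_notM P a b : prime_ideal P -> ~ P a -> ~ P b -> ~ P (a * b).
Proof. by move=> [_ _ hP] Pa Pb /hP[/Pa|/Pb]. Qed.

Lemma mem_lin1 B s x : is_submodule B -> x \in s -> lin setT B s x.
Proof.
move=> hB xs; have := mem_lin (Z := [set: R^o]) (z := 1) (subm_setT _) hB xs.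
by rewrite scale_mulE mulr1; apply.
Qed.

Lemma ideal_spanE s : ideal_span [set` s] = lin [set: R^o] [set 0] s.
Proof.
have hS : @is_submodule R R^o (ideal_span [set` s]) := span_subm _.
apply/seteqP; split.
  apply: (@span_le R R^o) => [|x xs].
    by apply: lin_subm => //; apply: subm_zero.
  by apply: mem_lin1 => //; apply: subm_zero.
apply: (@lin_le R R^o) => // [_ ->|x z xs _]; first exact: subm0.
by rewrite scale_mulE mulrC; apply: (idealMl z hS); by move=> N [_ sN]; apply: sN.
Qed.

Lemma lin1_le B A s : is_submodule A -> B `<=` A -> [set` s] `<=` A ->
  lin [set: R^o] B s `<=` A.
Proof.
move=> hA BA sA; apply: (@lin_le R R^o) => // x z xs _.
by rewrite scale_mulE mulrC; apply: idealMl => //; apply: sA.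
Qed.

Lemma noetherian_fg A : noetherian R -> is_submodule A ->
  exists s, A = lin setT [set 0] s.
Proof.
by move=> hN /hN[S /finite_seqP[s ->] <-]; exists s; rewrite ideal_spanE.
Qed.

(** Otherwise choice yields a strictly increasing chain in [F]; its union is finitely generated, and
    the generators already lie in one member. *)
Lemma noetherian_maximal (F : set (set R)) A0 : noetherian R -> F A0 ->
  (forall A, F A -> is_ideal A) ->
  exists2 A, F A & forall B, F B -> A `<=` B -> B `<=` A.
Proof.
move=> hN FA0 Fi; apply: contrapT => no.
have /choice[f hf] : forall A, exists B, F A -> [/\ F B, A `<=` B & ~ B `<=` A].
  move=> A; have [FA|] := pselect (F A); last by exists A.
  apply: contrapT => nB; apply: no; exists A => // B FB AB.
  by apply: contrapT => BA; apply: nB; exists B.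
pose c n := iter n f A0.
have Fc n : F (c n) by elim: n => [//|n /hf[]].
have cS n : c n `<=` c n.+1 by case: (hf _ (Fc n)).
have c_le k n : (k <= n)%N -> c k `<=` c n.
  elim: n => [|n IH]; first by rewrite leqn0 => /eqP->.
  rewrite leq_eqVlt => /predU1P[->//|/IH h]; exact: subset_trans (cS n).
have hU : is_ideal (\bigcup_n c n).
  split=> [|a u v [n _ cu] [k _ cv]]; first by exists 0%N => //; apply: (@subm0 R R^o); apply: Fi.
  exists (maxn n k) => //; apply: submD; first exact: Fi.
    by apply: submZ; [apply: Fi|apply: c_le cu; apply: leq_maxl].
  by apply: c_le cv; apply: leq_maxr.
have [s Us] := noetherian_fg hN hU.
have [n sn] : exists n, [set` s] `<=` c n.
  have : [set` s] `<=` \bigcup_n c n by rewrite Us => x; apply: mem_lin1; apply: subm_zero.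
  elim: s {Us} => [|x s IH] h; first by exists 0%N.
  have [|n hn] := IH; first by move=> y ys; apply: h; rewrite /= inE (ys : y \in s) orbT.
  have [|k _ hk] := h x; first by rewrite /= mem_head.
  exists (maxn n k) => y; rewrite /= inE => /predU1P[->|/hn].
    by apply: c_le hk; apply: leq_maxr.
  by apply: c_le; apply: leq_maxl.
have [_ _] := hf _ (Fc n); apply=> x cx.
have : (\bigcup_n c n) x by exists n.+1.
rewrite Us; apply: lin1_le => //; first exact: Fi.
by move=> _ ->; apply: (@subm0 R R^o); apply: Fi.
Qed.

(* The preimage in R of the extension of A to the localization of R at Q.     *)
Definition sat Q A : set R^o := [set u | exists2 s : R, ~ Q s & A (s *: u)].

Lemma sat_subm Q A : prime_ideal Q -> is_submodule A -> is_submodule (sat Q A).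
Proof.
move=> hQ hA; split.
  by exists 1; [case: hQ|rewrite scaler0; apply: subm0].
move=> a u v [s Qs Au] [t Qt Av]; exists (s * t); first exact: prime_notM.
rewrite scalerDr; apply: submD => //; last by rewrite -scalerA; apply: submZ.
by rewrite scalerA -mulrA mulrC -scalerA; apply: submZ.
Qed.

Lemma sub_sat Q A : prime_ideal Q -> A `<=` sat Q A.
Proof. by move=> [_ Q1 _] u Au; exists 1; rewrite ?scale1r. Qed.

Lemma satS Q A B : A `<=` B -> sat Q A `<=` sat Q B.
Proof. by move=> AB u [s Qs /AB]; exists s. Qed.

Lemma sat_sat Q A : prime_ideal Q -> sat Q (sat Q A) `<=` sat Q A.
Proof.
move=> hQ u [s Qs [t Qt]]; rewrite scalerA => Au; exists (t * s) => //.
exact: prime_notM.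
Qed.

Lemma sat_le Q A B : prime_ideal Q -> A `<=` sat Q B -> sat Q A `<=` sat Q B.
Proof. by move=> hQ AB u /(satS AB); apply: sat_sat. Qed.

Lemma sat_prime P Q : prime_ideal P -> P `<=` Q -> sat Q P `<=` P.
Proof. by move=> hP PQ u [s Qs /primeM]; apply => // /PQ. Qed.

(** Generators are eliminated one at a time: in the relation for [u], its coefficient becomes s - q
    with s outside Q and q in Q, a unit of the localization at Q. *)
Lemma nakayama_gens Q G us : prime_ideal Q -> is_submodule G ->
  [set` us] `<=` sat Q (lin Q G us) -> [set` us] `<=` sat Q G.
Proof.
move=> hQ hG; have hQ' := prime_subm hQ; elim: us => [//|u us IH] hus.
have Lu : sat Q (lin Q G us) u.
  have [|s Qs] := hus u; first by rewrite /= mem_head.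
  rewrite lin_cons => /addxP[q Qq]; rewrite scale_mulE [_ *: _]scale_mulE [u * q]mulrC.
  rewrite -mulrBl => h; exists (s - q) => // Qsq; apply: Qs.
  by rewrite -(subrK q s); apply: (@submD _ R^o).
have Lsub : lin Q G (u :: us) `<=` sat Q (lin Q G us).
  rewrite lin_cons; apply: addx_le; first by apply: sat_subm => //; apply: (@lin_subm R R^o).
    exact: sub_sat.
  move=> q Qq; rewrite scale_mulE mulrC; apply: idealMl => //.
  by apply: sat_subm => //; apply: (@lin_subm R R^o).
have {}IH : [set` us] `<=` sat Q G.
  apply: IH => w ws; apply: sat_le Lsub _ _ => //; apply: hus.
  by rewrite /= inE (ws : w \in us) orbT.
move=> w; rewrite /= inE => /predU1P[->|/IH //].
apply: (sat_le hQ _ Lu); apply: (@lin_le R R^o); first exact: sat_subm.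
  exact: sub_sat.
move=> x z xs _; rewrite scale_mulE mulrC; apply: idealMl; first exact: sat_subm.
exact: IH.
Qed.

Lemma nakayama Q F G us : prime_ideal Q -> is_submodule G ->
  F = lin setT [set 0] us ->
  [set` us] `<=` sat Q (lin Q G us) -> F `<=` sat Q G.
Proof.
move=> hQ hG -> /nakayama_gens h; apply: lin1_le; first exact: sat_subm.
  by move=> _ ->; apply: (@subm0 R R^o); apply: sat_subm.
exact: h.
Qed.

Lemma lin_mul Q G us x w : is_submodule Q -> is_submodule G -> Q x ->
  lin setT [set 0] us w -> lin Q G us (x *: w).
Proof.
move=> hQ hG Qx; elim: us w => [|u us IH] w; first by move=> ->; rewrite scaler0; apply: subm0.
rewrite !lin_cons => /addxP[z _ /IH h]; apply/addxP; exists (z * x).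
  exact: idealMl.
by rewrite [z * x]mulrC -[u *: (x * z)]mulrCA -scalerBr.
Qed.

End Ideals.

(** * Krull's principal ideal theorem *)

Section PrincipalIdealTheorem.
Variable R : comNzRingType.
Hypothesis hN : noetherian R.
Implicit Types (A B F G : set R^o) (P Q : set R).


Lemma mem_addx B x : is_submodule B -> addx B setT x x.
Proof.
move=> hB; have := @addxr _ _ B setT x (1 : R^o) hB I.
by rewrite scale_mulE mulr1.
Qed.

(* R/(B) localized at Q' is Artinian. The proof takes an ideal F maximal      *)
(* among those on which the chain stabilizes modulo x: if F were proper, then  *)
(* a maximal colon ideal F : g would be prime, hence equal to Q', and F + (g)  *)
(* would still qualify.                                                        *)
Lemma chain_stable_mod (D : nat -> set R^o) Q' B (x : R) :
  (forall n, is_submodule (D n)) -> (forall n, D n.+1 `<=` D n) ->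
  (forall n, B `<=` addx (D n) setT x) ->
  prime_ideal Q' -> is_submodule B ->
  (forall P, prime_ideal P -> B `<=` P -> P `<=` Q' -> Q' `<=` P) ->
  exists n, D n `<=` sat Q' (addx (D n.+1) setT x).
Proof.
move=> hD DS BD hQ' hB hmin.
have D_le k n : (k <= n)%N -> D n `<=` D k.
  elim: n => [|n IH]; first by rewrite leqn0 => /eqP->.
  by rewrite leq_eqVlt => /predU1P[->//|/IH]; apply: subset_trans.
pose E n := sat Q' (addx (D n.+1) setT x).
have hE n : is_submodule (E n) by apply: sat_subm => //; apply: addx_subm.
pose good (F : set R^o) := exists n0, forall n, (n0 <= n)%N -> forall u, D n u -> F u -> E n u.
pose Phi (F : set R^o) := [/\ @is_submodule R R^o F, B `<=` F, sat Q' F `<=` F & good F].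
have PhiB : Phi (sat Q' B).
  split; [exact: sat_subm|exact: sub_sat|exact: sat_sat|].
  by exists 0%N => n _ u _; apply: satS.
have [F [hF BF satF [n0 gF]] maxF] : exists2 F : set R^o, Phi F &
    forall G : set R^o, Phi G -> F `<=` G -> G `<=` F.
  by apply: noetherian_maximal PhiB _ => // A [].
have [F1|F1] := pselect (F 1).
  exists n0 => u Du; apply: (gF _ (leqnn _)) => //.
  by rewrite -[u]mulr1; apply: idealMl.
exfalso.
pose colon g : set R^o := [set a | F (a * g)].
have colonI g : @is_submodule R R^o (colon g).
  split; first by rewrite /colon /= mul0r; apply: subm0.
  move=> a u v; rewrite /colon /= => Fu Fv; rewrite mulrDl -mulrA.
  by apply: submD => //; apply: idealMl.
have [T [g [Fg ->]] maxT] : exists2 T, (exists g, ~ F g /\ T = colon g) &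
    forall G, (exists g, ~ F g /\ G = colon g) -> T `<=` G -> G `<=` T.
  apply: (@noetherian_maximal _ _ (colon 1)) => //; first by exists 1.
  by move=> _ [g [_ ->]]; apply: colonI.
have primeT : prime_ideal (colon g).
  split; [exact: colonI|by rewrite /colon /= mul1r|] => a b.
  rewrite /colon /= => Fab; have [|Fb] := pselect (F (b * g)); first by right.
  left; apply: (maxT (colon (b * g))); first by exists (b * g).
    by move=> c; rewrite /colon /= mulrCA => Fc; apply: idealMl.
  by rewrite /colon /= mulrA.
have Tg q : Q' q -> F (q * g).
  apply: (hmin _ primeT).
    by move=> b Bb; rewrite /colon /= mulrC; apply: idealMl => //; apply: BF.
  by move=> t Ft; apply: contrapT => Qt; apply: Fg; apply: satF; exists t.
have FG : F `<=` sat Q' (addx F setT g).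
  by apply: subset_trans (sub_sat hQ'); apply: addxl.
have hG : is_submodule (addx F setT g) by apply: addx_subm.
apply: Fg; apply: (maxF (sat Q' (addx F setT g))) => //; last first.
  by apply: sub_sat => //; apply: mem_addx.
split; [exact: sat_subm|exact: subset_trans FG|exact: sat_sat|].
(* Modulo F, the ideal F + (g) is locally a line over the residue field of Q'. Either some [D n1]
   meets it only inside F, or each [D n.+1] contains a w in it outside F, and every u of [D n] in it
   is locally a multiple of w modulo F. *)
have [[n1 h1]|no] := pselect (exists n1, forall u, D n1 u -> sat Q' (addx F setT g) u -> F u).
  exists (maxn n0 n1) => n; rewrite geq_max => /andP[n0n n1n] u Du Gu.
  by apply: gF => //; apply: h1 => //; apply: D_le Du.
exists n0 => n n0n u Du [s Qs /addxP[c' _ Fc']].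
have [w [Dw Gw Fw]] : exists w, [/\ D n.+1 w, sat Q' (addx F setT g) w & ~ F w].
  apply: contrapT => nw; apply: no; exists n.+1 => w Dw Gw.
  by apply: contrapT => Fw; apply: nw; exists w.
move: Gw => [t Qt /addxP[c _ Fc]].
have Qc : ~ Q' c.
  move=> /Tg Fcg; apply: Fw; apply: satF; exists t => //.
  rewrite -[t *: w](subrK (g *: c)); apply: submD => //.
  by rewrite scale_mulE mulrC.
have : E n (c *: (s *: u) - c' *: (t *: w)).
  apply: gF => //.
    by apply: (submB (hD n)); do 2!apply: (submZ _ (hD n)) => //; apply: DS.
  have -> : c *: (s *: u) - c' *: (t *: w) = c *: (s *: u - g *: c') - c' *: (t *: w - g *: c).
    have e : c' *: (g *: c) = c *: (g *: c').
      by rewrite !scale_mulE mulrCA [c' * c]mulrC mulrCA.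
    by rewrite !scalerBr opprB addrA e subrK.
  by apply: submB => //; apply: submZ.
move=> hcs; have : E n (c *: (s *: u)).
  rewrite -[X in E n X](subrK (c' *: (t *: w))); apply: (submD (hE n)); first exact: hcs.
  by do 2!apply: (submZ _ (hE n)); apply: sub_sat => //; apply: addxl.
rewrite scalerA => -[r Qr Er]; exists (r * (c * s)); last by rewrite -scalerA.
by do !apply: prime_notM.
Qed.


(** Modulo P, the symbolic powers of Q stabilize at some n up to x. As x is outside Q, locally at Q'
    the ideal [D n] lies in [D n.+1] + x [D n], and Nakayama gives [D n] inside [D n.+1]. Then Q^n
    lies in P + Q Q^n locally at Q, and a second Nakayama puts Q^n inside P. *)
Lemma principal_ideal_theorem P Q Q' (x : R) :
  prime_ideal P -> prime_ideal Q -> prime_ideal Q' ->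
  P `<=` Q -> Q `<=` Q' -> Q' x -> ~ Q x ->
  (forall Q'', prime_ideal Q'' -> P `<=` Q'' -> Q'' x -> Q'' `<=` Q' -> Q' `<=` Q'') ->
  Q `<=` P.
Proof.
move=> hP hQ hQ' PQ QQ' Q'x Qx hmin.
have hPs := prime_subm hP; have hQs := prime_subm hQ; have hQs' := prime_subm hQ'.
pose S n : set R^o := [set a + b | a in (P : set R^o) & b in (ideal_exp Q n : set R^o)].
have hS n : is_submodule (S n).
  have hE : @is_submodule R R^o (ideal_exp Q n) := ideal_exp_ideal Q n.
  split; first by exists 0; [exact: subm0|exists 0; [exact: subm0|rewrite addr0]].
  move=> a _ _ [u1 Pu1 [v1 Ev1 <-]] [u2 Pu2 [v2 Ev2 <-]].
  exists (a *: u1 + u2); first by apply: submD => //; apply: submZ.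
  exists (a *: v1 + v2); first by apply: submD => //; apply: submZ.
  by rewrite scalerDr addrACA.
have PS n : P `<=` S n.
  by move=> u Pu; exists u => //; exists 0; [case: (ideal_exp_ideal Q n)|rewrite addr0].
(* The symbolic powers of Q modulo P. *)
pose D n := sat Q (S n).
have hD n : is_submodule (D n) by apply: sat_subm.
have DS n : D n.+1 `<=` D n.
  apply: satS => _ [a Pa [b Eb <-]]; exists a => //; exists b => //.
  by apply: ideal_exp_le Eb.
have hB : is_submodule (addx (P : set R^o) setT x) by apply: addx_subm.
have [n Dn] : exists n, D n `<=` sat Q' (addx (D n.+1) setT x).
  apply: (chain_stable_mod hD DS _ hQ' hB).
    move=> n; apply: addx_le; first exact: addx_subm.
      move=> u Pu; apply: addxl => //; apply: sub_sat => //; exact: PS.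
    by move=> z _; apply: addxr.
  move=> Q'' hQ'' BQ'' QQ''; apply: hmin => //.
    by move=> u Pu; apply: BQ''; apply: addxl.
  by apply: BQ''; apply: mem_addx.
have {}Dn : D n `<=` D n.+1.
  have [us Dus] := noetherian_fg hN (hD n).
  have h : D n `<=` sat Q' (D n.+1).
    apply: (nakayama hQ' _ Dus) => // u uus.
    have Du : D n u by rewrite Dus; apply: mem_lin1 => //; apply: subm_zero.
    have [s Qs /addxP[c _ Dc]] := Dn _ Du; exists s => //.
    have Dxc : D n (x *: c).
      rewrite -[x *: c](subKr (s *: (u : R^o))); apply: submB => //; first exact: submZ.
      exact: DS.
    have {}Dxc : D n c.
      by move: Dxc => [t Qt]; rewrite scalerA => h; exists (t * x) => //; apply: prime_notM.
    rewrite -[_ *: _](subrK (x *: c)); apply: submD; first exact: lin_subm.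
      exact: sub_lin.
    by apply: lin_mul => //; rewrite -Dus.
  apply: subset_trans h _ => u [s Qs hs]; apply: (sat_sat hQ); exists s => // /QQ' //.
have QnP : ideal_exp Q n `<=` P.
  have hE : @is_submodule R R^o (ideal_exp Q n) := ideal_exp_ideal Q n.
  have [us Eus] := noetherian_fg hN hE.
  apply: subset_trans (sat_prime hP PQ); apply: (nakayama hQ _ Eus) => // u uus.
  have : D n u.
    apply: sub_sat => //; exists 0; first exact: subm0.
    exists u; rewrite ?add0r //= Eus; apply: mem_lin1 => //; apply: subm_zero.
  move=> /Dn; apply: satS => _ [a Pa [b Eb <-]].
  apply: submD; [exact: lin_subm|exact: sub_lin|].
  apply: Eb; split; first exact: lin_subm.
  by move=> _ [y Qy [z Ez <-]]; apply: (lin_mul (x := y)) => //; rewrite -Eus.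
move=> u Qu; have : P (u ^+ n).
  apply: QnP; elim: n {Dn} => [//|n IH]; rewrite exprS => N [_]; apply.
  by exists u => //; exists (u ^+ n).
elim: n {Dn QnP} => [|n IH]; first by case: hP.
by rewrite exprS; case: hP => _ _ hP' /hP'[].
Qed.

(** If x is outside Q and no such prime exists, Q' is minimal over P + (x), and the principal ideal
    theorem collapses Q onto P. *)
Lemma prime_between P Q Q' (x : R) :
  prime_ideal P -> prime_ideal Q -> prime_ideal Q' ->
  P `<` Q -> Q `<` Q' -> Q' x -> exists Q'',
  [/\ prime_ideal Q'', P `<` Q'', Q'' `<` Q' & Q'' x].
Proof.
move=> hP hQ hQ' [PQ nQP] [QQ' nQQ'] Q'x.
have [Qx|Qx] := pselect (Q x); first by exists Q.
apply: contrapT => no; apply: nQP.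
apply: (principal_ideal_theorem hP hQ hQ' PQ QQ' Q'x Qx) => Q'' hQ'' PQ'' Qx'' QQ''.
apply: contrapT => nQ; apply: no; exists Q''; split=> //; split=> // QP.
by apply: Qx; apply: PQ; apply: QP.
Qed.

End PrincipalIdealTheorem.

(** * Regular systems of parameters *)

Section RegularLocal.
Variables (R : comNzRingType) (m : set R).
Hypotheses (hN : noetherian R) (hloc : local_ring m).
Implicit Types (A B G : set R^o) (P Q : set R) (l s : seq R).

(** From the top down, [prime_between] replaces each intermediate prime by one containing x. *)
Lemma chain_through (x : R) n (P : nat -> set R) :
  prime_chain P n.+1 -> P n.+1 x -> exists P' : nat -> set R,
  [/\ prime_chain P' n.+1, P' 0%N = P 0%N, P' n.+1 = P n.+1 & P' 1%N x].
Proof.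
elim: n P => [|n IH] P [prP ltP] Px; first by exists P; split.
have [Q [prQ PQ QP Qx]] : exists Q, [/\ prime_ideal Q, P n `<` Q, Q `<` P n.+2 & Q x].
  apply: (prime_between hN (prP n _) (prP n.+1 _) (prP n.+2 _) (ltP n _) (ltP n.+1 _) Px) => //.
  exact: leqW (leqnSn n).
have [||P' [[prP' ltP'] P'0 P'n P'x]] := IH (fun i => if i == n.+1 then Q else P i).
- split=> i; first by case: eqP => // _ /leqW /prP.
  rewrite ltnS => hi; rewrite (ltn_eqF (_ : (i < n.+1)%N)) // eqSS.
  by case: eqP => [->//|_]; apply: ltP; rewrite ltnS leqW.
- by rewrite eqxx.
rewrite /= eqxx in P'n.
exists (fun i => if i == n.+2 then P n.+2 else P' i); split=> //; first split=> i.
- rewrite leq_eqVlt ltnS; case: eqP => [_ _|_ /=]; [exact: prP|exact: prP'].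
- rewrite ltnS => hi; rewrite (ltn_eqF (_ : (i < n.+2)%N)) // eqSS.
  by case: eqP => [->|/eqP ni]; [rewrite P'n|apply: ltP'; rewrite ltn_neqAle ni].
by rewrite eqxx.
Qed.

Lemma prime_chain_shift n (P : nat -> set R) :
  prime_chain P n.+1 -> prime_chain (fun i => P i.+1) n.
Proof. by move=> [prP ltP]; split=> i hi; [apply: prP|apply: ltP]. Qed.

Lemma local_idealM A : is_submodule A -> ~ A 1 -> A `<=` m.
Proof.
move=> hA A1.
have [N [hN' AN N1] maxN] : exists2 N : set R, [/\ is_ideal N, A `<=` N & ~ N 1] &
    forall B : set R, [/\ is_ideal B, A `<=` B & ~ B 1] -> N `<=` B -> B `<=` N.
  by apply: (noetherian_maximal hN (A0 := A)); [split|move=> B []].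
have [_ uniq_m] := hloc; rewrite -(uniq_m N) //; split=> // B hB B1 NB.
by apply/seteqP; split=> //; apply: (maxN _ _ NB); split=> //; apply: subset_trans NB.
Qed.

Lemma local_subm : @is_submodule R R^o m. Proof. by case: hloc => -[]. Qed.

Lemma local_notin (s : R) : ~ m s -> exists t : R, t * s = 1.
Proof.
move=> ms; apply: contrapT => no; apply: ms.
have h0 : @is_submodule R R^o (addx [set 0] setT s) by apply: addx_subm => //; apply: subm_zero.
apply: (local_idealM h0); last by apply: mem_addx; apply: subm_zero.
move=> /addxP[t _ /eqP]; rewrite subr_eq0 => /eqP e.
by apply: no; exists t; rewrite mulrC; exact/esym.
Qed.

Lemma local_prime : prime_ideal m.
Proof.
have [[hm m1 _] _] := hloc; split=> // x y mxy.
have [|/local_notin[t tx]] := pselect (m x); first by left.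
right; have := idealMl t hm mxy; by rewrite mulrA tx mul1r.
Qed.

Lemma sat_local A : is_submodule A -> sat m A `<=` A.
Proof.
move=> hA u [s /local_notin[t ts] /(idealMl t hA)].
by rewrite scale_mulE mulrA ts mul1r.
Qed.

Fixpoint primeseq B l : Prop :=
  prime_ideal B /\
  if l is x :: l' then ~ B x /\ primeseq (addx B setT x) l' else True.

(** With m as top prime, the chain is pulled through the first generator x, and by induction its
    second prime is B + (x). If b + x c lies in P 0, then so does c, as x is outside P 0; hence P 0
    = B + x P 0, and Nakayama gives P 0 = B. *)
Lemma primeseq_chain l B (P : nat -> set R) : is_submodule B ->
  lin setT B l = m -> B `<=` P 0%N -> prime_chain P (size l) ->
  P 0%N = B /\ primeseq B l.
Proof.
elim: l B P => [|x l IH] B P hB /= Bm BP chP.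
  have pr0 : prime_ideal (P 0%N) := proj1 chP _ (leq0n _).
  have e : P 0%N = B.
    apply/seteqP; split=> //; rewrite -[B]/(lin setT B [::]) Bm.
    by apply: local_idealM; case: pr0.
  by rewrite -e.
set n := size l in chP *.
have mx : m x.
  by rewrite -Bm; apply: sub_lin => //; apply: mem_addx.
have hB' : is_submodule (addx B setT x) by apply: addx_subm.
have [P' [chP' P'0 _ P'x]] : exists P' : nat -> set R,
    [/\ prime_chain P' n.+1, P' 0%N = P 0%N, P' n.+1 = m & P' 1%N x].
  have [||P' [c1 c2 c3 c4]] := @chain_through x n (fun i => if i == n.+1 then m else P i).
  - case: chP => prP ltP; split=> i.
      by case: eqP => // _; [move=> _; apply: local_prime|apply: prP].
    rewrite ltnS => hi; rewrite (ltn_eqF (_ : (i < n.+1)%N)) // eqSS.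
    case: eqP => [->|_]; last by apply: ltP.
    have [sub ne] := ltP n (leqnn _).
    have Pm : P n.+1 `<=` m by have [hP P1 _] := prP _ (leqnn n.+1); apply: local_idealM.
    by split; [apply: subset_trans Pm|move=> mP; apply: ne; apply: subset_trans mP].
  - by rewrite eqxx.
  by rewrite eqxx in c3; exists P'.
have [|P'1 prs] := IH _ _ hB' Bm _ (prime_chain_shift chP').
  apply: (@addx_le R R^o).
  - by case: (proj1 chP' 1%N isT).
  - rewrite -P'0 in BP; apply: subset_trans BP _.
    by case: (proj2 chP' 0%N isT).
  by move=> z _; rewrite scale_mulE mulrC; apply: idealMl => //; case: (proj1 chP' 1%N isT).
have pr0 : prime_ideal (P 0%N) := proj1 chP _ (leq0n _).
have P0x : ~ P 0%N x.
  move=> Px; case: chP' => _ /(_ 0%N isT); rewrite P'1 P'0 => -[_]; apply.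
  apply: (@addx_le R R^o) => // [|z _]; first exact: prime_subm.
  by rewrite scale_mulE mulrC; apply: (idealMl _ (prime_subm pr0)).
suff e : P 0%N = B by rewrite e in pr0 P0x *; split.
have h0 := prime_subm pr0.
apply/seteqP; split=> //; have [us Pus] := noetherian_fg hN h0.
apply: subset_trans (sat_local hB).
apply: (nakayama local_prime hB Pus) => u uus; apply: sub_sat; first exact: local_prime.
have Pu : P 0%N u by rewrite Pus; apply: mem_lin1 => //; apply: subm_zero.
have : P' 1%N u by case: chP' => _ /(_ 0%N isT); rewrite P'0 => -[/(_ _ Pu)].
rewrite P'1 => /addxP[c _ Bc].
have Pc : P 0%N c.
  apply: (primeM pr0 P0x); rewrite -[x *: c](subKr (u : R^o)).
  by apply: (@submB R R^o) => //; apply: BP.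
have := local_subm => hm; rewrite -[u](subrK (x *: c)); apply: (@submD R R^o).
- by apply: lin_subm.
- by apply: sub_lin.
- by apply: lin_mul => //; rewrite -Pus.
Qed.

Lemma primeseq_regseq B s t (a : R) : primeseq B (s ++ t) -> ~ lin setT B s a ->
  regseq setT B (rcons s a).
Proof.
elim: s B => [|x s IH] B /=.
  move=> prB Ba; split=> // z _; apply: primeM => //.
  by case: t prB => [|? ?] [].
move=> [prB [Bx prs]] Bsa; split; first by move=> z _; apply: primeM.
exact: IH.
Qed.

(** When [Q] is the maximal ideal, the coefficient c is a unit, so x can be traded for a. *)
Lemma lin_split (Q : set R^o) B s a : is_submodule B -> lin setT B s a ->
  lin Q B s a \/ exists s1 x s2 c,
    [/\ s = s1 ++ x :: s2, ~ Q c & lin setT B (s1 ++ s2) (a - c * x)].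
Proof.
move=> hB; elim: s a => [|y s IH] a; first by left.
rewrite !lin_cons => /addxP[c _ Bc].
have [Qc|Qc] := pselect (Q c); last first.
  by right; exists [::], y, s, c; split=> //; rewrite mulrC.
have [h|[s1 [x [s2 [d [es Qd h]]]]]] := IH _ Bc.
  by left; apply/addxP; exists c.
right; exists (y :: s1), x, s2, d; split; rewrite ?es // cat_cons lin_cons.
by apply/addxP; exists c => //; rewrite addrAC.
Qed.

Lemma lin0_subm s : is_submodule (lin [set: R^o] [set 0] s).
Proof. by apply: lin_subm => //; apply: subm_zero. Qed.

Lemma mem_lin0 s x : x \in s -> lin [set: R^o] [set 0] s x.
Proof. by apply: mem_lin1; apply: subm_zero. Qed.

Lemma lin0_le A s : is_submodule A -> [set` s] `<=` A ->
  lin [set: R^o] [set 0] s `<=` A.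
Proof. by move=> hA sA; apply: lin1_le => // _ ->; apply: subm0. Qed.

Lemma lin0_sub s t : {subset s <= t} ->
  lin [set: R^o] [set 0] s `<=` lin [set: R^o] [set 0] t.
Proof. by move=> st; apply: lin0_le => [|x /st]; [apply: lin0_subm|apply: mem_lin0]. Qed.

(** Dropping the last or the first prime leaves a chain for [primeseq_chain], so the first two
    primes would both be zero. *)
Lemma system_minimal l (P : nat -> set R) :
  lin [set: R^o] [set 0] l = m -> ~ prime_chain P (size l).+1.
Proof.
move=> lm chP; have h0 := @subm_zero R R^o.
have le0 i : (i <= (size l).+1)%N -> [set 0] `<=` P i.
  by move=> /(proj1 chP)[hP _ _] _ ->; case: hP.
have chP' : prime_chain P (size l).
  by case: chP => prP ltP; split=> i hi; [apply: prP|apply: ltP]; apply: leqW.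
have [e1 _] := primeseq_chain h0 lm (le0 1%N isT) (prime_chain_shift chP).
have [e0 _] := primeseq_chain h0 lm (le0 0%N isT) chP'.
by have [_] := proj2 chP 0%N isT; rewrite e0 e1; apply.
Qed.

(* If all coefficients of the new generator a over the remaining generators of *)
(* the larger ideal were in m, then a would be redundant by Nakayama and fewer *)
(* than r elements would generate m.                                           *)
Lemma exchange (P : nat -> set R) (x wx z wz : seq R) :
  prime_chain P (size (x ++ wx)) -> size (z ++ wz) = size (x ++ wx) ->
  lin [set: R^o] [set 0] (x ++ wx) = m -> lin [set: R^o] [set 0] (z ++ wz) = m ->
  lin [set: R^o] [set 0] x `<=` lin setT [set 0] z ->
  exists2 ys, lin [set: R^o] [set 0] (x ++ ys) = lin setT [set 0] z &
    size (x ++ ys) = size z.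
Proof.
move=> chP szx + zm; elim/last_ind: x wx chP szx => [|x a IH] wx chP szx xm xz.
  by exists z.
rewrite cat_rcons in chP szx xm.
have [|ys ez szy] := IH _ chP szx xm.
  by apply: subset_trans xz; apply: lin0_sub => y; rewrite mem_rcons inE orbC => ->.
have xysz : [set` x ++ ys] `<=` lin [set: R^o] [set 0] z.
  by rewrite -ez => y; apply: mem_lin0.
have za : lin [set: R^o] [set 0] z a.
  by apply: xz; apply: mem_lin0; rewrite mem_rcons mem_head.
have : lin [set: R^o] [set 0] (x ++ ys) a by rewrite ez.
rewrite {1}lin_cat => /(lin_split (m : set R^o))[||].
- exact: lin0_subm.
- move=> la; exfalso; apply: (@system_minimal (x ++ wx) P).
    apply/seteqP; split.
      by rewrite -xm; apply: lin0_sub => y; rewrite !mem_cat inE => /orP[->//|->]; rewrite !orbT.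
    have hm := local_subm; have [us mus] := noetherian_fg hN hm.
    apply: subset_trans (sat_local (lin0_subm _)).
    have hG := lin0_subm (x ++ wx).
    have hL : is_submodule (lin (m : set R^o) (lin [set: R^o] [set 0] (x ++ wx)) us).
      exact: lin_subm.
    apply: (nakayama local_prime hG mus) => u uus.
    apply: sub_sat; first exact: local_prime.
    have : lin [set: R^o] [set 0] (x ++ a :: wx) u.
      by rewrite xm mus; apply: mem_lin0.
    apply: (lin0_le hL) => y; rewrite /= mem_cat inE orbCA -mem_cat => /predU1P[->|yxw]; last first.
      by apply: sub_lin => //; apply: mem_lin0.
    apply: lin_le la => // [|q t qy mt].
      by apply: subset_trans (sub_lin _ hm); apply: lin0_sub => q; rewrite mem_cat => ->.
    apply: lin_mul => //; last by rewrite -mus.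
    rewrite -zm; apply: (@lin0_sub z) => [w|]; first by rewrite mem_cat => ->.
    by apply: xysz; rewrite /= mem_cat qy orbT.
  by rewrite size_cat -addnS -[(size wx).+1]/(size (a :: wx)) -size_cat.
(* The coefficient [c] of [y] is a unit: [a] takes the place of [y] and the length is unchanged. *)
move=> [y1 [y [y2 [c [eys mc la]]]]].
exists (y1 ++ y2); last first.
  by rewrite -szy eys !size_cat size_rcons /= !addnS addSn.
apply/seteqP; split.
  apply: lin0_le => [|q]; first exact: lin0_subm.
  rewrite /= mem_cat mem_rcons inE -orbA => /predU1P[->//|qx]; apply: xysz.
  by move: qx; rewrite /= eys !mem_cat inE => /or3P[] ->; rewrite ?orbT.
rewrite -ez; have hS := lin0_subm (rcons x a ++ y1 ++ y2).
have le_S : lin [set: R^o] [set 0] (x ++ y1 ++ y2) `<=`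
    lin setT [set 0] (rcons x a ++ y1 ++ y2).
  by apply: lin0_sub => q; rewrite !mem_cat mem_rcons inE => /or3P[] ->; rewrite ?orbT.
apply: (lin0_le hS) => q; rewrite /= eys !mem_cat inE.
rewrite (orbCA (q \in y1)) orbCA => /predU1P[->|qxy]; last first.
  by apply: le_S; apply: mem_lin0; rewrite !mem_cat.
have [t tc] := local_notin mc.
rewrite -[y]mul1r -tc -mulrA; apply: (idealMl t hS).
have Sa : lin [set: R^o] [set 0] (rcons x a ++ y1 ++ y2) a.
  by apply: mem_lin0; rewrite mem_cat mem_rcons mem_head.
by have := submB hS Sa (le_S (a - c * y) _); rewrite subKr lin_cat; apply.
Qed.

Lemma part_of_system r (A : set R) :
  generated_by_part_of_regular_system m r A -> exists s t,
  [/\ A = lin [set: R^o] [set 0] s, lin [set: R^o] [set 0] (s ++ t) = m & size (s ++ t) = r].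
Proof.
move=> [S [T [[Sr Sm] TS <-]]].
have Sfin : finite_set S by apply/finite_setP; exists r.
pose l := finmap.enum_fset (fset_set S).
have lS : S = [set` l].
  apply/seteqP; split=> x; first by move=> Sx; rewrite /l /= (in_fset_set Sfin) mem_set.
  by rewrite /l /= (in_fset_set Sfin) => /set_mem.
pose p := [pred x | x \in T].
exists [seq x <- l | p x], [seq x <- l | predC p x]; split.
- rewrite -ideal_spanE; congr ideal_span; apply/seteqP; split=> x /=.
    move=> Tx; rewrite mem_filter /= mem_set //=; have := TS _ Tx; by rewrite lS.
  by rewrite mem_filter => /andP[/= /set_mem].
- rewrite -Sm lS ideal_spanE; apply: eq_lin => //; first exact: subm_zero.
  by move=> x; rewrite mem_cat !mem_filter -andb_orl /= orbN.
by rewrite size_cat !size_filter count_predC (card_fset_set Sr).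
Qed.

End RegularLocal.

(** * Injective modules over a Noetherian ring *)

Section InjectiveModules.
Variables (R : comNzRingType) (N : lmodType R).
Hypothesis injN : injective_module N.

(** A homomorphism from an ideal to N is multiplication by the value at 1 of its extension to R. It
    is given by its graph, which the third condition makes single-valued. *)
Lemma injective_extend (K : submodule R^o) (G : R^o -> N -> Prop) :
  (forall u, submodule_set K u -> exists v, G u v) ->
  (forall a u u' v v', G u v -> G u' v' -> G (a *: u + u') (a *: v + v')) ->
  (forall v, G 0 v -> v = 0) ->
  exists e, forall u v, submodule_set K u -> G u v -> v = u *: e.
Proof.
move=> totG linG G0.
have uniqG u v v' : G u v -> G u v' -> v = v'.
  move=> h h'; have := linG (-1) _ _ _ _ h' h.
  by rewrite !scaleN1r addNr => /G0/eqP; rewrite addrC subr_eq0 => /eqP.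
have /choice[g hg] : forall w : submod_type K, exists v, G (\val w) v.
  by case=> w hw; apply: totG; exact: set_mem hw.
have lin_g : linear g.
  move=> a u v; apply: (uniqG (\val (a *: u + v))); first exact: hg.
  by rewrite linearP; apply: linG; apply: hg.
pose gL : {linear submod_type K -> N} :=
  HB.pack g (GRing.isLinear.Build R (submod_type K) N *:%R g lin_g).
have [h hh] := @injN (submod_type K) R^o \val gL val_inj.
exists (h 1) => u v Ku Guv.
pose w : submod_type K := exist _ u (mem_set Ku).
have e : h u = g w := hh w.
have <- : h u = u *: h 1 by rewrite -linearZ /= scale_mulE mulr1.
by rewrite e; apply: uniqG Guv (hg w).
Qed.

(** At the s where the annihilators of the x^s e stop growing, t + x^(s+n) r |-> x^s r e is well
    defined on Ann(e) + (x^(s+n)); e' is the value at 1 of an extension. Since Ann(e) kills e',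
    division preserves l-torsion. *)
Lemma injective_divide (x : R) n (e : N) : noetherian R ->
  exists e' s, x ^+ s *: (x ^+ n *: e' - e) = 0 /\
    forall a : R, a *: e = 0 -> a *: e' = 0.
Proof.
move=> hN.
pose A s : set R := [set r | (x ^+ s * r) *: e = 0].
have hA s : is_ideal (A s).
  split; first by rewrite /A /= mulr0 scale0r.
  move=> a u v; rewrite /A /= => hu hv.
  by rewrite mulrDr scalerDl hv addr0 mulrCA -scalerA hu scaler0.
have [_ [s ->] maxA] : exists2 B : set R, (exists s, B = A s) &
    forall C : set R, (exists s, C = A s) -> B `<=` C -> C `<=` B.
  apply: (noetherian_maximal hN (A0 := A 0%N)); first by exists 0%N.
  by move=> _ [s ->]; apply: hA.
have stab r : (x ^+ (s + n) * r) *: e = 0 -> (x ^+ s * r) *: e = 0.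
  apply: (maxA (A (s + n)%N)); first by exists (s + n)%N.
  by move=> q; rewrite /A /= => hq; rewrite exprD [x ^+ s * _]mulrC -mulrA -scalerA hq scaler0.
have hAnn : @is_submodule R R^o [set a : R^o | a *: e = 0].
  split; first exact: scale0r.
  by move=> a u v /= hu hv; rewrite scalerDl hv addr0 -scalerA hu scaler0.
have hK : @is_submodule R R^o (addx [set a : R^o | a *: e = 0] setT (x ^+ (s + n))).
  exact: addx_subm.
pose G (u : R^o) (v : N) := exists t r : R,
  [/\ t *: e = 0, u = t + x ^+ (s + n) * r & v = (x ^+ s * r) *: e].
have [|||e' he'] := @injective_extend (Submodule hK) G.
- by move=> _ [t te [r _ <-]]; exists ((x ^+ s * r) *: e), t, r.
- move=> a u u' v v' [t [r [te -> ->]]] [t' [r' [te' -> ->]]].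
  exists (a * t + t'), (a * r + r'); split.
  + by rewrite scalerDl te' addr0 -scalerA te scaler0.
  + by rewrite scale_mulE !mulrDr addrACA [a * (_ * r)]mulrCA.
  + by rewrite mulrDr scalerDl mulrCA scalerA.
- move=> v [t [r [te e0 ->]]]; apply: stab.
  have := congr1 (fun b => b *: e) e0; rewrite scale0r scalerDl te add0r => <- //.
exists e', s; split.
  rewrite scalerBr scalerA -exprD; apply/eqP; rewrite subr_eq0; apply/eqP/esym.
  apply: he'; last by exists 0, 1; split; rewrite ?scale0r ?mulr1 ?add0r.
  exact: mem_addx.
move=> a ae; apply/esym; apply: he'; last first.
  by exists a, 0; split; rewrite ?mulr0 ?addr0 ?scale0r.
by exists a => //; exists 0 => //; rewrite scaler0 addr0.
Qed.

End InjectiveModules.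

(** * Adding a generator to the torsion ideal *)

Section Torsion.
Variable R : comNzRingType.
Implicit Types (N : lmodType R) (x : R) (l s : seq R).

(** Torsion is tested on generators, so that a new generator adds a separate condition;
    [torsion_tors] relates this to powers of the ideal. *)
Definition tors l N : set N :=
  [set e | forall x, x \in l -> exists n, x ^+ n *: e = 0].

Lemma exp_kill x k n N (e : N) : x ^+ k *: e = 0 -> (k <= n)%N -> x ^+ n *: e = 0.
Proof. by move=> xe /subnK<-; rewrite exprD -scalerA xe scaler0. Qed.

Lemma tors_subm l N : is_submodule (@tors l N).
Proof.
split=> [x _|a u v tu tv x xl]; first by exists 0%N; rewrite scaler0.
have [n xu] := tu _ xl; have [k xv] := tv _ xl; exists (maxn n k).
rewrite scalerDr (exp_kill xv (leq_maxr _ _)) addr0 scalerA mulrC -scalerA.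
by rewrite (exp_kill xu (leq_maxl _ _)) scaler0.
Qed.

Lemma tors0 l N : tors l (0 : N). Proof. exact: subm0 (tors_subm _ _). Qed.

Lemma torsD l N (u v : N) : tors l u -> tors l v -> tors l (u + v).
Proof. exact: submD (tors_subm _ _). Qed.

Lemma torsB l N (u v : N) : tors l u -> tors l v -> tors l (u - v).
Proof. exact: submB (tors_subm _ _). Qed.

Lemma torsZ l N a (u : N) : tors l u -> tors l (a *: u).
Proof. exact: submZ (tors_subm _ _). Qed.

Lemma torsP x l N (e : N) :
  tors (x :: l) e <-> (exists n, x ^+ n *: e = 0) /\ tors l e.
Proof.
split=> [te|[xe te] y]; last by rewrite inE => /predU1P[->|/te].
by split=> [|y yl]; apply: te; rewrite inE ?eqxx // yl orbT.
Qed.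

Lemma tors_linear l N N' (f : {linear N -> N'}) e : tors l e -> tors l (f e).
Proof. by move=> te x /te[n xe]; exists n; rewrite -linearZ /= xe linear0. Qed.

Lemma tors_divide (x : R) (n : nat) l N (e : N) : noetherian R -> injective_module N ->
  tors l e -> exists e' (s : nat), tors l e' /\ x ^+ s *: (x ^+ n *: e' - e) = 0.
Proof.
move=> hN iN te; have [e' [s [he ae]]] := injective_divide iN x n e hN.
by exists e', s; split=> // y /te[k /ae]; exists k.
Qed.

End Torsion.

(** * Cohomology of the l-torsion of a resolution *)

Section Complex.
Variables (R : comNzRingType) (M : lmodType R) (E : injective_resolution M).
Hypothesis hN : noetherian R.
Implicit Types (x : R) (l s t : seq R) (i n : nat).

Local Notation d := (res_diff E _).

Definition cocycles l i : set (res_obj E i) :=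
  [set z | tors l z /\ res_diff E i z = 0].

Definition coboundaries l i : set (res_obj E i) :=
  match i return set (res_obj E i) with
  | 0 => [set 0]
  | j.+1 => [set res_diff E j y | y in @tors R l (res_obj E j)]
  end.

Arguments cocycles : clear implicits.
Arguments coboundaries : clear implicits.
Local Notation Zc := cocycles.
Local Notation Bc := coboundaries.

Lemma diffK i (y : res_obj E i) : d (d y) = 0.
Proof. by apply/res_exact; exists y. Qed.

Lemma cocycles_subm l i : is_submodule (Zc l i).
Proof.
split; first by split; [exact: tors0|rewrite linear0].
move=> a u v [tu du] [tv dv]; split; first by apply: torsD => //; apply: torsZ.
by rewrite linearP du dv scaler0 addr0.
Qed.

Lemma coboundaries_subm l i : is_submodule (Bc l i).
Proof.
case: i => [|i]; first exact: subm_zero.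
split; first by exists 0; [exact: tors0|rewrite linear0].
move=> a _ _ [u tu <-] [v tv <-]; exists (a *: u + v); last by rewrite linearP.
by apply: torsD => //; apply: torsZ.
Qed.

Lemma cocycles_cons x l i : Zc (x :: l) i `<=` Zc l i.
Proof. by move=> z [/torsP[_ tz] dz]. Qed.

Lemma coboundaries_cons x l i : Bc (x :: l) i `<=` Bc l i.
Proof. by case: i => [//|i] _ [y /torsP[_ ty] <-]; exists y. Qed.

(* [z' = d e] with [e = z / x^n] up to x-torsion: the class of z' is the image *)
(* of z / x^n under the connecting map of 0 -> C' -> C -> C_x -> 0.          *)
Definition connecting x l i n (z : res_obj E i) (z' : res_obj E i.+1) : Prop :=
  exists e (s : nat), [/\ tors l e, z' = res_diff E i e & x ^+ s *: (x ^+ n *: e - z) = 0].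

(** With N the cohomology in degree i, the right-hand side says that z/x^n vanishes in N_x/N. It
    amounts to correcting the lift [e] by cocycles until it is x-torsion. *)
Lemma connecting_ker x l i n z z' : Zc l i z -> connecting x l n z z' ->
  (Bc (x :: l) i.+1 z' <->
   exists k, addx (Bc l i) (Zc l i) (x ^+ (n + k)) (x ^+ k *: z)).
Proof.
move=> [tz dz] [e [s [te -> /eqP]]]; rewrite scalerBr subr_eq0 scalerA -exprD => /eqP hs.
split.
  move=> [f /torsP[[q xf] tf] /eqP]; rewrite -subr_eq0 -linearB => /eqP def.
  exists (s + q)%N; apply/addxP; exists (e - f).
    split; first exact: torsB.
    by rewrite -opprB linearN def oppr0.
  have -> : x ^+ (s + q) *: z = x ^+ (n + (s + q)) *: e.
    rewrite [(s + q)%N]addnC exprD -scalerA -hs scalerA -exprD.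
    by congr (x ^+ _ *: e); lia.
  rewrite -scalerBr subKr (exp_kill xf); first exact: subm0 (coboundaries_subm _ _).
  by rewrite addnA leq_addl.
move=> [k /addxP[w [tw dw] Bb]].
(* Dividing a primitive of the coboundary by x^(n+k) in the injective module shows that the
   coboundary is x^(n+k) times a cocycle [g], up to x-torsion. *)
have [g [r [tg dg hr]]] : exists (g : res_obj E i) r,
    [/\ tors l g, d g = 0 &
      x ^+ r *: (x ^+ k *: z - x ^+ (n + k) *: w) = x ^+ (r + (n + k)) *: g].
  case: i z {z'} tz dz e te hs w tw dw Bb => [|i] z tz dz e te hs w tw dw /=.
    by move=> ->; exists 0, 0%N; split; rewrite ?scaler0 ?linear0 //; exact: tors0.
  move=> [g tg <-]; have [g' [r [tg' /(congr1 (res_diff E i))]]] :=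
    tors_divide x (n + k) hN (@res_injective R M E i) tg.
  rewrite linear0 linearZ linearB linearZ /= scalerBr => /eqP; rewrite subr_eq0 => /eqP h.
  by exists (d g'), r; split; [apply: tors_linear|apply: diffK|rewrite -h scalerA -exprD].
exists (e - w - g); last by rewrite !linearB /= dw dg !subr0.
apply/torsP; split; last by apply: torsB => //; apply: torsB.
exists (s + (r + (n + k)))%N.
have hg : x ^+ (s + (r + (n + k))) *: g =
    x ^+ (s + r + k) *: z - x ^+ (s + (r + (n + k))) *: w.
  by rewrite exprD -scalerA -hr !scalerBr !scalerA -!exprD !addnA.
have he : x ^+ (s + (r + (n + k))) *: e = x ^+ (s + r + k) *: z.
  have -> : (s + (r + (n + k)) = r + k + (s + n))%N by lia.
  by rewrite exprD -scalerA hs scalerA -exprD addnC addnA.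
by rewrite !scalerBr hg he subrr.
Qed.

Lemma connecting_onto x l i z' :
  (forall z, Zc l i.+1 z -> Bc l i.+1 (x *: z) -> Bc l i.+1 z) ->
  Zc (x :: l) i.+1 z' -> exists n, exists2 z, Zc l i z & connecting x l n z z'.
Proof.
move=> regx [/torsP[[n xz] tz] dz].
have [e te dez] : Bc l i.+1 z'.
  have : Bc l i.+1 (x ^+ n *: z') by rewrite xz; apply: subm0; apply: coboundaries_subm.
  elim: n {xz} => [|n IH]; first by rewrite expr0 scale1r.
  rewrite exprS -scalerA => /regx h; apply: IH; apply: h.
  by apply: submZ; first exact: cocycles_subm.
exists n, (x ^+ n *: e); first split.
- exact: torsZ.
- by rewrite linearZ /= dez.
by exists e, 0%N; split=> //; rewrite subrr scaler0.
Qed.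

(** Regularity of x leaves no H^0_x of the cohomology in degree i + 1, so only N_x/N remains, N
    being the cohomology in degree i. *)
Lemma connecting_colimit x l i :
  (forall z, Zc l i.+1 z -> Bc l i.+1 (x *: z) -> Bc l i.+1 z) ->
  colimit (Zc l i) (fun n => addx (Bc l i) (Zc l i) (x ^+ n)) x
    (Zc (x :: l) i.+1) (Bc (x :: l) i.+1) (connecting x l (i := i)).
Proof.
move=> regx; split; last by move=> n z z' Zz _ /connecting_ker; apply.
- move=> n z [tz dz].
  have [e [s [te hs]]] := tors_divide x n hN (@res_injective R M E i) tz.
  exists (d e); last by exists e, s.
  split; last exact: diffK.
  apply/torsP; split; last exact: tors_linear.
  exists (s + n)%N; have := congr1 (res_diff E i) hs.
  by rewrite linear0 linearZ linearB linearZ /= dz subr0 scalerA -exprD.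
- by move=> z' /(connecting_onto regx).
- move=> n a z w z' w' [e [s [te -> hs]]] [f [r [tf -> hr]]].
  exists (a *: e + f), (maxn s r); split; last 1 first.
  + have -> : x ^+ n *: (a *: e + f) - (a *: z + w) =
        a *: (x ^+ n *: e - z) + (x ^+ n *: f - w).
      by rewrite scalerDr opprD addrACA scalerBr !scalerA [a * _]mulrC.
    rewrite scalerDr (exp_kill hr (leq_maxr _ _)) addr0 scalerA mulrC -scalerA.
    by rewrite (exp_kill hs (leq_maxl _ _)) scaler0.
  + by apply: torsD => //; apply: torsZ.
  + by rewrite linearP.
move=> n z z' [e [s [te -> hs]]]; exists e, s; split=> //.
by rewrite exprS -scalerA -scalerBr scalerA mulrC -scalerA hs scaler0.
Qed.

Lemma cocycles0_cons x l : (forall z, Zc l 0 z -> x *: z = 0 -> z = 0) ->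
  Zc (x :: l) 0 `<=` [set 0].
Proof.
move=> regx z [/torsP[[n xz] tz] dz] /=; elim: n xz => [|n IH]; first by rewrite expr0 scale1r.
rewrite exprS -scalerA => /regx h; apply: IH; apply: h.
by apply: submZ; first exact: cocycles_subm.
Qed.

Lemma regseq_cocycles_cons x l s :
  (forall i, regseq (Zc l i) (Bc l i) (x :: s)) ->
  forall i, regseq (Zc (x :: l) i) (Bc (x :: l) i) s.
Proof.
move=> reg [|i].
  apply: regseq_trivial; first exact: cocycles_subm.
  by apply: cocycles0_cons => z Zz xz; case: (reg 0%N) => /(_ z Zz) + _; apply.
apply: colimit_regseq (connecting_colimit _) _; try exact: cocycles_subm.
- by move=> n; apply: addx_subm; [exact: coboundaries_subm|exact: cocycles_subm].
- exact: coboundaries_subm.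
- by case: (reg i.+1).
move=> n; case: (reg i) => regx regs; apply: regseq_exp => //.
  exact: cocycles_subm.
exact: coboundaries_subm.
Qed.

Lemma regseq_cocycles_catrev ys l s :
  (forall i, regseq (Zc l i) (Bc l i) (ys ++ s)) ->
  forall i, regseq (Zc (catrev ys l) i) (Bc (catrev ys l) i) s.
Proof. by elim: ys l => [//|y ys IH] l /regseq_cocycles_cons/IH. Qed.

(** As x kills the cohomology N in degree i, N_x/N is zero. *)
Lemma cocycles_cons_vanish x l i :
  (forall z, Zc l i.+1 z -> Bc l i.+1 (x *: z) -> Bc l i.+1 z) ->
  (forall z, Zc l i z -> Bc l i (x *: z)) ->
  Zc (x :: l) i.+1 `<=` Bc (x :: l) i.+1.
Proof.
move=> regx kill z' /(connecting_onto regx)[n [z Zz zz']].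
apply/(connecting_ker Zz zz'); exists 1%N; apply: addxl; first exact: cocycles_subm.
exact: kill.
Qed.

(** If x^n kills z = d e, then x^n e is a 0-cocycle, hence zero: the primitive is already
    x-torsion. *)
Lemma coboundaries1_cons x l z : Zc l 0 `<=` [set 0] ->
  Zc (x :: l) 1 z -> Bc l 1 z -> Bc (x :: l) 1 z.
Proof.
move=> H0 [/torsP[[n xz] _] _] [e te dez]; exists e => //; apply/torsP; split=> //.
exists n; apply: H0; split; first exact: torsZ.
by rewrite linearZ /= dez.
Qed.

(** If x^n z = d e, dividing e by x^n and subtracting the differential of the quotient makes z
    itself x-torsion. *)
Lemma cocycles1_cons x l n z : Zc l 1 z -> Bc l 1 (x ^+ n *: z) ->
  exists2 z', Zc (x :: l) 1 z' & Bc l 1 (z - z').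
Proof.
move=> [tz dz] [e te dez].
have [e' [s [te' /(congr1 (res_diff E 0))]]] := tors_divide x n hN (@res_injective R M E 0) te.
rewrite linear0 linearZ linearB linearZ /= dez -scalerBr scalerA -exprD => hs.
exists (z - d e'); last by rewrite subKr; exists e'.
split; last by rewrite linearB /= dz diffK subr0.
apply/torsP; split; last by apply: torsB => //; apply: tors_linear.
by exists (s + n)%N; rewrite -opprB scalerN hs oppr0.
Qed.

(** An x that kills H^1 leaves it unchanged, because H^0 = 0. The new H^2 vanishes, since H^1
    localized at x is zero, and above it each new module is a limit of quotients N/x^n N with N in
    degree at least 2. *)
Lemma regseq_cocycles_kill xs l t :
  Zc l 0 `<=` [set 0] -> regseq (Zc l 1) (Bc l 1) t ->
  (forall x z, x \in xs -> Zc l 1 z -> Bc l 1 (x *: z)) ->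
  (forall i, regseq (Zc l i.+2) (Bc l i.+2) (xs ++ t)) ->
  forall i, regseq (Zc (catrev xs l) i) (Bc (catrev xs l) i) t.
Proof.
elim: xs l => [|x xs IH] l H0 H1 kill H2.
  by case=> [|[|//]] //; apply: regseq_trivial => //; exact: cocycles_subm.
have kx z : Zc l 1 z -> Bc l 1 (x *: z) by apply: kill; rewrite mem_head.
apply: IH.
- by apply: subset_trans H0; apply: cocycles_cons.
(* The isomorphism between the two H^1 is a limit with constant stages and transition factor 1. *)
- pose rho (n : nat) (z z' : res_obj E 1) := Bc l 1 (z - z').
  have hB := coboundaries_subm l 1.
  apply: (@colimit_regseq _ _ _ (Zc l 1) (fun _ => Bc l 1) 1 _ _ rho) => //;
    do ?[exact: cocycles_subm|exact: coboundaries_subm].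
  split.
  + move=> n z Zz; apply: (@cocycles1_cons x l 1) => //; rewrite expr1; exact: kx.
  + move=> z' Zz'; exists 0%N, z'; first exact: cocycles_cons Zz'.
    by rewrite /rho subrr; apply: subm0.
  + move=> n a z w z' w' hz hw; rewrite /rho opprD addrACA -scalerBr.
    by apply: submD => //; apply: submZ.
  + by move=> n z z'; rewrite scale1r.
  move=> n z z' Zz Zz' hzz'; split=> [Bz'|[k]].
    exists 0%N; rewrite expr0 scale1r -(subrK z' z); apply: submD => //.
    exact: coboundaries_cons Bz'.
  rewrite expr1n scale1r => Bz; apply: coboundaries1_cons => //.
  by rewrite -(subKr z z'); apply: submB.
- move=> y z yxs Zz; apply: coboundaries1_cons => //.
    by apply: submZ; first exact: cocycles_subm.
  by apply: kill; [rewrite inE yxs orbT|apply: cocycles_cons Zz].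
case=> [|i].
  apply: regseq_trivial; first exact: cocycles_subm.
  by apply: cocycles_cons_vanish => //; case: (H2 0%N).
apply: colimit_regseq (connecting_colimit _) _; try exact: cocycles_subm.
- by move=> n; apply: addx_subm; [exact: coboundaries_subm|exact: cocycles_subm].
- exact: coboundaries_subm.
- by case: (H2 i.+1).
move=> n; case: (H2 i) => regx regs; apply: regseq_exp => //.
  exact: cocycles_subm.
exact: coboundaries_subm.
Qed.

Lemma cocycles_nil i : Zc [::] i.+1 `<=` Bc [::] i.+1.
Proof. by move=> z [_ /res_exact[y <-]]; exists y. Qed.

End Complex.

Arguments cocycles {R M} E l i.
Arguments coboundaries {R M} E l i.

(** * The first two generators of J *)

Lemma colimit_H2_ker (R : comNzRingType) (x1 x2 c j b : R) (n k k1 k2 k3 : nat) :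
  x1 ^+ k3 * (x2 ^+ k * (x1 ^+ k1 * (x1 * x2 * c))) =
    x1 ^+ (n.+1 + k1 + k3) * j + x1 ^+ k3 * (x2 ^+ (n.+1 + k) * (x1 ^+ k2 * b)) ->
  (x1 * x2) ^+ (k + k1 + k3).+1 * c =
    x1 ^+ (n + (k + k1 + k3).+1) * (x2 ^+ (k1 + k3) * j) +
    x2 ^+ (n + (k + k1 + k3).+1) * (x1 ^+ (k + k3) * x1 ^+ k2 * b).
Proof.
move=> h; transitivity (x1 ^+ k * x2 ^+ (k1 + k3) *
    (x1 ^+ k3 * (x2 ^+ k * (x1 ^+ k1 * (x1 * x2 * c))))).
  rewrite exprMn !exprS !exprD.
  move: (x1 ^+ k) (x1 ^+ k1) (x1 ^+ k2) (x1 ^+ k3) (x1 ^+ n)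
    (x2 ^+ k) (x2 ^+ k1) (x2 ^+ k3) (x2 ^+ n) => *; ring.
rewrite h !addSn !addnS !exprS !exprD.
move: (x1 ^+ k) (x1 ^+ k1) (x1 ^+ k2) (x1 ^+ k3) (x1 ^+ n)
  (x2 ^+ k) (x2 ^+ k1) (x2 ^+ k3) (x2 ^+ n) => *; ring.
Qed.

Lemma colimit_H2_coker (R : comNzRingType) (x1 x2 c f g : R) (n k : nat) :
  (x1 * x2) ^+ k * c = x1 ^+ (n + k) * g + x2 ^+ (n + k) * f ->
  x2 ^+ k * (x1 ^+ k * (x1 * x2 * c)) =
    x1 ^+ (n.+1 + k) * (x2 * g) + x2 ^+ (n.+1 + k) * (x1 * f).
Proof.
move=> h; transitivity (x1 * x2 * ((x1 * x2) ^+ k * c)).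
  by rewrite exprMn; move: (x1 ^+ k) (x2 ^+ k) => *; ring.
by rewrite h !addSn !exprS; move: (x1 ^+ _) (x2 ^+ _) => *; ring.
Qed.

Section TwoSteps.
Variables (R : comNzRingType) (J : set R^o) (x1 x2 : R) (M1 M2 : lmodType R).
Variables (Z1 B1 : set M1) (Z2 B2 : set M2).
Variables (sigma : nat -> R^o -> M1 -> Prop) (rho : nat -> M1 -> M2 -> Prop).
Hypotheses (hJ : is_submodule J) (hZ1 : is_submodule Z1) (hB1 : is_submodule B1).
Hypothesis hsigma :
  colimit J (fun n => addx [set 0] J (x1 ^+ n)) x1 Z1 B1 sigma.

(** The class of c/(x1 x2)^n is written x1 x2 c/(x1 x2)^(n+1): the shift by one brings the numerator
    into J. Likewise x2 g and x1 f bring the coefficients of a relation into J. *)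
Lemma colimit_H2 : J x1 -> J x2 ->
  colimit Z1 (fun n => addx B1 Z1 (x2 ^+ n)) x2 Z2 B2 rho ->
  colimit [set: R^o] (fun n => addx (addx [set 0] setT (x1 ^+ n)) setT (x2 ^+ n))
    (x1 * x2) Z2 B2
    (fun n c z2 => exists z1, [/\ Z1 z1, sigma n.+1 (x1 * x2 * c) z1 & rho n.+1 z1 z2]).
Proof.
move=> J1 J2 hrho.
have Jc c : J (x1 * x2 * c) by rewrite mulrAC; apply: (idealMl _ hJ J2).
split.
- move=> n c _; have [z1 Zz1 h1] := colim_tot hsigma n.+1 (Jc c).
  by have [z2 Zz2 h2] := colim_tot hrho n.+1 Zz1; exists z2 => //; exists z1.
- move=> z2 Zz2; have [p [z1 Zz1 h2]] := colim_onto hrho Zz2.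
  have [q [b Jb h1]] := colim_onto hsigma Zz1.
  have hup : rho (p + q)%N (x2 ^+ q *: z1) z2 := colim_upk q hrho h2.
  have hs : sigma (q + p)%N (x1 ^+ p *: (x2 ^+ q *: b)) (x2 ^+ q *: z1).
    by apply: (colim_upk p hsigma); apply: (colimZ _ hsigma).
  exists (p + q)%N, (x1 ^+ p *: (x2 ^+ q *: b)) => //.
  exists (x2 *: (x2 ^+ q *: z1)); split.
  + exact: (submZ _ hZ1 (submZ _ hZ1 Zz1)).
  + have := colim_up hsigma (colimZ x2 hsigma hs); rewrite [(q + p)%N]addnC.
    by rewrite !scale_mulE !mulrA.
  + exact: (colim_up hrho hup).
- move=> n a c c' z2 z2' [z1 [Zz1 h1 h2]] [z1' [Zz1' h1' h2']].
  exists (a *: z1 + z1'); split.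
  + by apply: submD => //; apply: submZ.
  + have := colim_lin hsigma a h1 h1'.
    by rewrite !scale_mulE mulrDr [a * (_ * c)]mulrCA.
  + exact: (colim_lin hrho).
- move=> n c z2 [z1 [Zz1 h1 h2]]; exists (x2 *: z1); split.
  + exact: submZ.
  + have := colim_up hsigma (colimZ x2 hsigma h1).
    by rewrite !scale_mulE !mulrA.
  + exact: (colim_up hrho).
move=> n c z2 _ Zz2 [z1 [Zz1 h1 h2]].
rewrite (colim_ker hrho Zz1 Zz2 h2); split.
  move=> [k /addxP[w Zw Bw]]; have [q [b Jb hw]] := colim_onto hsigma Zw.
  have [k1 [k2 [e hz hw']]] := colim_common hsigma h1 hw.
  have h := colimB hsigma (colimZ (x2 ^+ k) hsigma hz) (colimZ (x2 ^+ (n.+1 + k)) hsigma hw').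
  have [||k3 /addxP[j Jj]] := iffLR (colim_ker hsigma _ _ h) Bw.
  - by apply: (submB hJ); apply: (submZ _ hJ) => //; apply: (submZ _ hJ).
  - by apply: (submB hZ1); apply: (submZ _ hZ1).
  move=> /= /eqP; rewrite subr_eq0 !scale_mulE => /eqP hj.
  exists (k + k1 + k3).+1; apply/addxP; exists (x1 ^+ (k + k3) * x1 ^+ k2 * b) => //.
  apply/addxP; exists (x2 ^+ (k1 + k3) * j) => //=.
  apply/eqP; rewrite subr_eq0 subr_eq !scale_mulE; apply/eqP.
  move: hj; rewrite mulrBr => /eqP; rewrite subr_eq => /eqP hj.
  exact: colimit_H2_ker hj.
move=> [k /addxP[f _ /addxP[g _ /eqP]]]; rewrite subr_eq0 subr_eq !scale_mulE => /eqP hc.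
have J1f : J (x1 * f) by rewrite mulrC; apply: (idealMl _ hJ J1).
have J2g : J (x2 * g) by rewrite mulrC; apply: (idealMl _ hJ J2).
have [w Zw hw] := colim_tot hsigma (n.+1 + k)%N J1f.
exists k; apply/addxP; exists w => //.
have h := colimB hsigma (colimZ (x2 ^+ k) hsigma (colim_upk k hsigma h1))
  (colimZ (x2 ^+ (n.+1 + k)) hsigma hw).
apply: (iffRL (colim_ker hsigma _ _ h)).
- by apply: (submB hJ); apply: (submZ _ hJ) => //; apply: (submZ _ hJ).
- by apply: (submB hZ1); apply: (submZ _ hZ1).
exists 0%N; apply/addxP; exists (x2 * g) => //=; apply/eqP.
rewrite subr_eq0 expr0 scale1r addn0 subr_eq !scale_mulE; apply/eqP.
exact: colimit_H2_coker hc.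
Qed.

(** After x1 the cohomology is R_(x1)/J, whose x2-power torsion is R/J by regularity of x1, x2. An
    element c of R is written x1^(n+1) c/x1^(n+1), so that the numerator lies in J even for n =
    0. *)
Lemma colimit_H1 (Z' B' : set M1) : J x1 -> J x2 ->
  (forall z : R^o, x1 *: z = 0 -> z = 0) ->
  (forall n (z : R^o), addx [set 0] setT (x1 ^+ n) (x2 *: z) ->
    addx [set 0] setT (x1 ^+ n) z) ->
  Z' `<=` Z1 -> B' `<=` B1 -> (forall z, Z' z -> B1 z -> B' z) ->
  (forall z, Z' z -> exists n, x2 ^+ n *: z = 0) ->
  (forall n z, Z1 z -> B1 (x2 ^+ n *: z) -> exists2 z', Z' z' & B1 (z - z')) ->
  colimit [set: R^o] (fun=> J) 1 Z' B'
    (fun n c z' => exists z, [/\ Z1 z, sigma n.+1 (x1 ^+ n.+1 * c) z & B1 (z - z')]).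
Proof.
move=> J1 J2 reg1 reg2 sZ sB hB onto2 lift.
have regk k (z : R^o) : x1 ^+ k *: z = 0 -> z = 0.
  elim: k => [|k IH]; first by rewrite expr0 scale1r.
  by rewrite exprS -scalerA => /reg1/IH.
have Jx n c : J (x1 ^+ n.+1 * c).
  by rewrite exprS mulrC [x1 * _]mulrC mulrA; apply: (idealMl _ hJ).
have ker1 n (c : R^o) z : Z1 z -> sigma n.+1 (x1 ^+ n.+1 * c) z -> (B1 z <-> J c).
  move=> Zz h; rewrite (colim_ker hsigma (Jx n c) Zz h); split.
    move=> [k /addxP[j Jj /eqP]]; rewrite subr_eq0 => /eqP e.
    have : x1 ^+ (n.+1 + k) *: (c - j) = 0.
      by rewrite scalerBr -e !scale_mulE exprD mulrA [_ * x1 ^+ k]mulrC subrr.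
    by move=> /regk/eqP; rewrite subr_eq0 => /eqP->.
  move=> Jcc; exists 0%N; apply/addxP; exists c => //.
  by rewrite expr0 scale1r addn0 /= scale_mulE subrr.
split.
- move=> n c _; have [z Zz h] := colim_tot hsigma n.+1 (Jx n c).
  have [|z' Zz' Bz] := lift 1%N z Zz; last by exists z' => //; exists z.
  apply: (iffRL (ker1 n (x2 * c) _ _ _)).
  + exact: submZ.
  + by rewrite expr1 mulrCA; apply: (colimZ _ hsigma).
  + by rewrite mulrC; apply: (idealMl _ hJ J2).
- move=> z' Zz'; have [q xz] := onto2 _ Zz'.
  have [n [b Jb h]] := colim_onto hsigma (sZ _ Zz').
  have hq := colimZ (x2 ^+ q) hsigma h.
  have [|||k /addxP[j Jj /eqP]] := iffLR (colim_ker hsigma _ _ hq).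
  + exact: submZ.
  + by apply: submZ => //; apply: sZ.
  + by rewrite xz; apply: subm0.
  rewrite subr_eq0 exprD [x1 ^+ n * _]mulrC -scalerA => /eqP e.
  have {e} e : x2 ^+ q *: b - x1 ^+ n *: j = 0.
    by apply: (regk k); rewrite scalerBr e subrr.
  (* x2^q b is a multiple of x1^n, and x2 is regular modulo x1^n, so b is a multiple too and its
     class comes from R. *)
  have /addxP[c _ /eqP] : addx [set 0] [set: R^o] (x1 ^+ n) b.
    have : addx [set 0] [set: R^o] (x1 ^+ n) (x2 ^+ q *: b) by apply/addxP; exists j.
    elim: (q) => [|p IH]; first by rewrite expr0 scale1r.
    by rewrite exprS -scalerA => /reg2/IH.
  rewrite subr_eq0 => /eqP bc.
  exists n, c => //; exists z'; split; [exact: sZ| |by rewrite subrr; apply: subm0].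
  by have := colim_up hsigma h; rewrite bc scalerA -exprS.
- move=> n a c w z' w' [z [Zz h hz]] [y [Zy k hy]]; exists (a *: z + y); split.
  + by apply: submD => //; apply: submZ.
  + have := colim_lin hsigma a h k.
    by rewrite !scale_mulE mulrDr [a * (_ * c)]mulrCA.
  + by rewrite opprD addrACA -scalerBr; apply: submD => //; apply: submZ.
- move=> n c z' [z [Zz h hz]]; exists z; split=> //.
  by rewrite scale1r; have := colim_up hsigma h; rewrite scale_mulE mulrA -exprS.
move=> n c z' _ Zz' [z [Zz h hz]]; split.
  move=> Bz'; exists 0%N; rewrite expr0 scale1r; apply/(ker1 n c z Zz h).
  by rewrite -(subrK z' z); apply: submD => //; apply: sB.
move=> [k]; rewrite expr1n scale1r => /(ker1 n c z Zz h) Bz; apply: hB => //.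
by rewrite -(subKr z z'); apply: submB.
Qed.

End TwoSteps.

(** * Resolutions of an ideal *)

Section IdealResolution.
Variables (R : comNzRingType) (J : ideal R).
Variable E : injective_resolution (submod_type J).
Hypothesis hN : noetherian R.
Implicit Types (x : R) (l s t : seq R).

Local Notation Zc := (cocycles E).
Local Notation Bc := (coboundaries E).
Local Notation Js := (submodule_set J).
Local Notation zeroR := [set (0 : R^o)].

Definition ideal_elt (c : R^o) (Jc : Js c) : submod_type J :=
  exist _ c (mem_set Jc).

Lemma ideal_eltP (w : submod_type J) : Js (\val w).
Proof. by case: w => w hw; exact: set_mem hw. Qed.

Lemma aug_cocycle (w : submod_type J) : Zc [::] 0 (res_aug E w).
Proof. by split=> //; apply/res_aug_exact; exists w. Qed.

Lemma cocycle_aug z : Zc [::] 0 z -> exists w, res_aug E w = z.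
Proof. by move=> [_ /res_aug_exact]. Qed.

Lemma aug_eq0 w : res_aug E w = 0 -> \val w = 0 :> R^o.
Proof. by rewrite -(linear0 (res_aug E)) => /res_aug_inj->; rewrite linear0. Qed.

Lemma regseq_zero s : Js `<=` [set 0] -> forall i, regseq (Zc [::] i) (Bc [::] i) s.
Proof.
move=> J0 i; apply: regseq_trivial; first exact: cocycles_subm.
case: i => [|i]; last exact: cocycles_nil.
move=> z /cocycle_aug[w <-] /=.
have -> : w = 0 by apply: val_inj; rewrite linear0; apply: J0; exact: ideal_eltP.
by rewrite linear0.
Qed.

(** J is free on x, so the cohomology before any torsion is taken is R in degree 0 and zero
    above. *)
Lemma regseq_principal x s : submodule_set J = lin [set: R^o] zeroR [:: x] ->
  (forall z : R^o, x *: z = 0 -> z = 0) -> regseq [set: R^o] zeroR s ->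
  forall i, regseq (Zc [::] i) (Bc [::] i) s.
Proof.
move=> Jx regx regs [|i]; last first.
  by apply: regseq_trivial; [exact: cocycles_subm|exact: cocycles_nil].
pose rho (n : nat) (c : R^o) z := exists w : submod_type J, \val w = x *: c /\ res_aug E w = z.
apply: (@colimit_regseq _ _ _ [set: R^o] (fun=> zeroR) 1 _ _ rho) => //.
- by move=> _; apply: subm_zero.
- exact: cocycles_subm.
- exact: coboundaries_subm.
split.
- move=> n c _.
  have hc : Js (x *: c).
    by rewrite Jx; apply: mem_lin; rewrite ?mem_head //; apply: subm_zero.
  exists (res_aug E (ideal_elt hc)); first exact: aug_cocycle.
  by exists (ideal_elt hc).
- move=> z /cocycle_aug[w <-]; exists 0%N.
  have : lin [set: R^o] zeroR [:: x] (\val w).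
    by rewrite -Jx; apply: ideal_eltP.
  move=> /addxP[c _ /eqP]; rewrite subr_eq0 => /eqP e; exists c => //.
  by exists w.
- move=> n a c c' _ _ [w [e <-]] [w' [e' <-]]; exists (a *: w + w'); split; last exact: linearP.
  by rewrite linearP /= e e' scalerDr !scalerA [a * x]mulrC.
- by move=> n c z; rewrite scale1r.
move=> n c _ _ _ [w [e <-]]; split.
  move=> /aug_eq0; rewrite e => xc; exists 0%N; rewrite expr0 scale1r; exact: regx.
move=> [k]; rewrite expr1n scale1r /= => c0.
have -> : w = 0 by apply: val_inj; rewrite linear0 e c0 scaler0.
exact: linear0.
Qed.

Definition connectingJ x n (c : R^o) z := exists w : submod_type J,
  \val w = c /\ connecting x [::] n (res_aug E w) z.

(** This is [connecting_colimit] transported along the augmentation, which identifies J with the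
    0-cocycles. *)
Lemma connectingJ_colimit x :
  colimit Js (fun n => addx zeroR Js (x ^+ n)) x
    (Zc [:: x] 1) (Bc [:: x] 1) (connectingJ x).
Proof.
have [|tot onto lin_ up ker] := @connecting_colimit _ _ E hN x [::] 0.
  by move=> z Zz _; apply: cocycles_nil.
split.
- move=> n c Jc; have [z' Zz' h] := tot n _ (aug_cocycle (ideal_elt Jc)).
  by exists z' => //; exists (ideal_elt Jc).
- move=> z' /onto[n [z /cocycle_aug[w <-] h]]; exists n, (\val w).
    exact: ideal_eltP.
  by exists w.
- move=> n a c c' z z' [w [<- h]] [w' [<- h']]; exists (a *: w + w'); split; first exact: linearP.
  by rewrite linearP; apply: lin_.
- move=> n c z [w [<- h]]; exists (x *: w); split; first exact: linearZ.
  by rewrite linearZ; apply: up.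
move=> n c z Jc Zz [w [<- h]]; rewrite (ker _ _ _ (aug_cocycle w) Zz h).
split=> -[k /addxP[v]].
  move=> /cocycle_aug[u <-]; rewrite -!linearZ -linearB => /aug_eq0 e.
  exists k; apply/addxP; exists (\val u); first by case: (u) => q hq; exact: set_mem hq.
  by rewrite -e linearB !linearZ.
move=> Jv e; exists k; apply/addxP; exists (res_aug E (ideal_elt Jv)).
  exact: aug_cocycle.
rewrite -!linearZ -linearB /=.
suff -> : x ^+ k *: w - x ^+ (n + k) *: ideal_elt Jv = 0 by rewrite linear0.
by apply: val_inj; rewrite linearB !linearZ linear0 /= scalerN.
Qed.

Lemma regseq_two_steps x1 x2 xs t : Js x1 -> Js x2 -> [set` xs] `<=` Js ->
  regseq [set: R^o] zeroR [:: x1, x2 & xs ++ t] -> regseq [set: R^o] Js t ->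
  forall i, regseq (Zc (catrev [:: x1, x2 & xs] [::]) i)
    (Bc (catrev [:: x1, x2 & xs] [::]) i) t.
Proof.
move=> J1 J2 Jxs [reg1 [reg2 regs]] regt.
have reg1' (z : R^o) : x1 *: z = 0 -> z = 0 by move=> xz; apply: reg1.
have hJ := submoduleP J; have hs := connectingJ_colimit x1.
have hz := @subm_zero R R^o.
have hx n : is_submodule (addx zeroR setT (x1 ^+ n)) by apply: addx_subm.
have reg12 n : regseq [set: R^o] (addx zeroR setT (x1 ^+ n)) (x2 :: xs ++ t).
  by apply: regseq_exp.
have H00 : Zc [:: x1] 0 `<=` [set 0].
  apply: cocycles0_cons => z /cocycle_aug[w <-]; rewrite -linearZ => /aug_eq0.
  rewrite linearZ /= => /reg1' w0; have -> : w = 0 by apply: val_inj; rewrite linear0.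
  exact: linear0.
have van1 i : Zc [:: x1] i.+2 `<=` Bc [:: x1] i.+2.
  apply: cocycles_cons_vanish => // z Zz; first by move=> _; apply: cocycles_nil.
  by apply: submZ; [exact: coboundaries_subm|exact: cocycles_nil].
have van2 i : Zc [:: x2; x1] i.+3 `<=` Bc [:: x2; x1] i.+3.
  apply: cocycles_cons_vanish => // z Zz; first by move=> _; apply: van1.
  by apply: submZ; [exact: coboundaries_subm|exact: van1].
have h1 : colimit [set: R^o] (fun=> Js) 1 (Zc [:: x2; x1] 1) (Bc [:: x2; x1] 1)
    (fun n c z' => exists z, [/\ Zc [:: x1] 1 z,
      connectingJ x1 n.+1 (x1 ^+ n.+1 * c) z & Bc [:: x1] 1 (z - z')]).
  apply: (colimit_H1 (x2 := x2) hJ (cocycles_subm _ _ _) (coboundaries_subm _ _ _) hs) => //.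
  - by move=> n z hz'; case: (reg12 n) => /(_ z I hz').
  - exact: cocycles_cons.
  - exact: coboundaries_cons.
  - by move=> z; apply: coboundaries1_cons.
  - by move=> z [/torsP[]].
  - by move=> n z; apply: cocycles1_cons.
(* The remaining generators [xs] lie in J, so they kill H^1 = R/J; on the limit in degree 2 they
   form a regular sequence with [t], and from degree 3 on there is nothing. *)
apply: (regseq_cocycles_kill hN (l := [:: x2; x1])).
- by apply: subset_trans H00; apply: cocycles_cons.
- apply: (colimit_regseq _ _ _ _ h1) => //; [exact: cocycles_subm|exact: coboundaries_subm].
- move=> x z' xxs Zz'; have [n [c _ h]] := colim_onto h1 Zz'.
  apply: (iffRL (colim_ker h1 _ _ (colimZ x h1 h))) => //.
    by apply: submZ => //; apply: cocycles_subm.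
  exists 0%N; rewrite expr0 scale1r scale_mulE mulrC; apply: idealMl => //; exact: Jxs.
case=> [|i]; last first.
  by apply: regseq_trivial; [exact: cocycles_subm|exact: van2].
have h2 := colimit_H2 hJ (cocycles_subm _ _ _) hs J1 J2
  (connecting_colimit hN (fun z Zz _ => van1 0%N z Zz)).
apply: (colimit_regseq _ _ _ _ h2) => //; try exact: cocycles_subm.
- by move=> n; apply: addx_subm.
- exact: coboundaries_subm.
by move=> n; case: (reg12 n) => r2 rs; apply: regseq_exp.
Qed.

End IdealResolution.

(** For exponents g x killing e, a product of one more generator than the sum of the g x kills e,
    since each factor uses up one exponent. The extra factor covers the empty list, where I = 0 but
    I^0 = R. *)
Lemma torsion_tors (R : comNzRingType) (I : ideal R) (N : lmodType R) l (e : N) :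
  submodule_set I = lin [set: R^o] [set 0] l -> torsion I e <-> tors l e.
Proof.
move=> Il; split.
  move=> [n In] x xl; exists n; apply: In.
  have Ix : submodule_set I x by rewrite Il; apply: mem_lin0.
  elim: n => [//|n IH]; rewrite exprS => A [_]; apply; exists x => //; by exists (x ^+ n).
have hAnn (f : N) : @is_submodule R R^o [set a : R^o | a *: f = 0].
  split; first exact: scale0r.
  by move=> a u v /= hu hv; rewrite scalerDl hv addr0 -scalerA hu scaler0.
suff H n (f : N) (g : R -> nat) : (\sum_(x <- l) g x <= n)%N ->
    (forall x, x \in l -> x ^+ g x *: f = 0) ->
    forall a, ideal_exp I n.+1 a -> a *: f = 0.
  move=> te; have /choice[g hg] : forall x : R, exists n, x \in l -> x ^+ n *: e = 0.
    by move=> x; case: (boolP (x \in l)) => [/te[n h]|_]; [exists n|exists 0%N].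
  by exists (\sum_(x <- l) g x).+1; apply: (H _ _ g).
elim: n f g => [|n IH] f g gn hg a Ia.
  apply: (Ia [set b : R | b *: f = 0]); split; first exact: hAnn.
  move=> _ [y Iy [b _ <-]] /=; rewrite mulrC -scalerA.
  suff -> : y *: f = 0 by rewrite scaler0.
  move: Iy; rewrite Il; move: y; apply: (lin0_le (hAnn f)) => y yl /=.
  move: gn; rewrite leqn0 sum_nat_seq_eq0 => /allP/(_ y yl)/eqP g0.
  by have := hg y yl; rewrite g0 expr0 scale1r => ->; rewrite scaler0.
apply: (Ia [set b : R | b *: f = 0]); split; first exact: hAnn.
move=> _ [y Iy [b Ib <-]] /=; rewrite -scalerA.
move: Iy; rewrite Il; move: y; apply: (lin0_le (hAnn _)) => y yl /=.
rewrite scalerA mulrC -scalerA.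
case gy : (g y) => [|k].
  by have := hg y yl; rewrite gy expr0 scale1r => ->; rewrite !scaler0.
(* Passing from f to y f lowers the exponent of y by one. *)
apply: (IH (y *: f) (fun x => if x == y then k else g x)) => //.
  rewrite -ltnS; apply: leq_trans gn.
  rewrite (big_rem y yl) [X in (_ < X)%N](big_rem y yl) /= eqxx gy addSn ltnS leq_add2l.
  by apply: leq_sum => x _; case: eqP => // ->; rewrite gy.
move=> x xl; case: eqP => [->|_]; first by rewrite scalerA -exprSr -gy; apply: hg.
by rewrite scalerA mulrC -scalerA hg // scaler0.
Qed.

(** * Associated primes *)

Lemma quot_pi_eq0 (R : comNzRingType) (M : lmodType R) (N : submodule M) (x : M) :
  (\pi_(quot_mod N) x)%qT = 0 <-> submodule_set N x.
Proof. by rewrite -[0]/(quot_zero N) quot_eqP subr0. Qed.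

(** Torsion puts I inside P. An element of P outside I would be injective and yet kill the class
    with annihilator P, so that class would be zero and P would contain 1. *)
Lemma Ass_local_cohomology (R : comNzRingType) (I : ideal R) (M : lmodType R)
    (E : injective_resolution M) i l :
  submodule_set I = lin [set: R^o] [set 0] l ->
  (forall a : R, ~ submodule_set I a ->
    regseq (cocycles E l i) (coboundaries E l i) [:: a]) ->
  Ass (local_cohomology I E i) `<=` [set submodule_set I].
Proof.
move=> Il reg P [prP [y]]; move: y; apply: quot_ind => z e.
have Pz a : P a <-> @lc_coboundary_set R I M E i (\val (a *: z)).
  rewrite e /=; have -> : a *: (\pi_(quot_mod (lc_coboundary I E i)) z)%qT =
      (\pi_(quot_mod (lc_coboundary I E i)) (a *: z))%qT by exact: quot_scaleE.
  exact: quot_pi_eq0.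
have hB u : @lc_coboundary_set R I M E i u <-> coboundaries E l i u.
  case: i {z e Pz reg} u => [//|i] u; split=> -[v tv <-]; exists v => //.
    by apply/(torsion_tors _ Il).
  by apply/(torsion_tors _ Il).
have [Iz dz] : @lc_cocycle_set R I M E i (\val z) by case: z {e Pz} => z hz; exact: set_mem hz.
have Zz : cocycles E l i (\val z) by split=> //; apply/(torsion_tors _ Il).
have [hP P1 prP'] := prP.
apply/seteqP; split=> a; last first.
  move=> Ia; have [n In] := Iz.
  have : P (a ^+ n).
    apply/Pz/hB; rewrite linearZ /= In; first exact: subm0 (coboundaries_subm _ _ _).
    elim: n {In} => [//|n IH]; rewrite exprS => A [_]; apply; exists a => //; by exists (a ^+ n).
  by elim: n {In} => [//|n IH]; rewrite exprS => /prP'[].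
move=> Pa; apply: contrapT => /reg[rega _]; apply: P1.
apply/Pz/hB; rewrite scale1r; apply: rega => //.
by have /Pz/hB := Pa; rewrite linearZ.
Qed.

Lemma primeseq_cat (R : comNzRingType) (B : set R^o) s t :
  primeseq B (s ++ t) -> primeseq (lin setT B s) t.
Proof. by elim: s B => [//|x s IH] B /= [_ [_ /IH]]. Qed.

Lemma regseq_cocycles_parts (R : comNzRingType) (J : ideal R) xs ys ws
    (E : injective_resolution (submod_type J)) (a : R) : noetherian R ->
  submodule_set J = lin [set: R^o] [set 0] xs ->
  primeseq [set (0 : R^o)] (xs ++ ys ++ ws) ->
  ~ lin [set: R^o] [set 0] (xs ++ ys) a ->
  forall i, regseq (cocycles E (catrev (xs ++ ys) [::]) i)
    (coboundaries E (catrev (xs ++ ys) [::]) i) [:: a].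
Proof.
move=> hN Jx prs Ia.
have reg0 : regseq [set: R^o] [set 0] (xs ++ ys ++ [:: a]).
  by rewrite catA cats1; apply: (primeseq_regseq (t := ws)); rewrite // -catA.
(* The generators of J are adjoined before those of I alone, so the case split concerns [xs]
   only. *)
have -> : catrev (xs ++ ys) [::] = catrev ys (catrev xs [::]).
  by rewrite !catrevE rev_cat catA.
apply: (regseq_cocycles_catrev hN).
case: xs Jx prs Ia reg0 => [|x1 [|x2 xs]] Jx prs Ia reg0.
- by apply: regseq_zero; rewrite Jx.
- apply: (regseq_cocycles_catrev hN (ys := [:: x1])).
  have [reg1 _] := reg0.
  by apply: (regseq_principal E Jx) => // z; apply: reg1.
have mJ x : x \in [:: x1, x2 & xs] -> submodule_set J x by rewrite Jx; apply: mem_lin0.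
apply: regseq_two_steps => //.
- by apply: mJ; rewrite mem_head.
- by apply: mJ; rewrite !inE eqxx orbT.
- by move=> x xxs; apply: mJ; rewrite !inE (xxs : x \in xs) !orbT.
rewrite Jx cats1; apply: (primeseq_regseq (t := ws)); first exact: primeseq_cat.
by rewrite -lin_cat.
Qed.

Theorem proposition5p6 (R : comNzRingType) (m : set R) (r p : nat)
  (I J : ideal R)
  (hR : regular_local_ring m r)
  (hLC : LC_finite R)
  (hr : (r <= 7)%N)
  (hp : residue_char m p)
  (hIJ : J `<=` I)
  (hI : generated_by_part_of_regular_system m r I)
  (hJ : generated_by_part_of_regular_system m r J)
  (hpJ : submodule_set J (p%:R : R) \/
         ~ ideal_add (ideal_mul m m) J p%:R) :
  forall i : nat, lc_Ass_finite I (submod_type J) i.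
Proof.
have [hN hloc [[P chP] _] _] := hR.
have [xs [wx [Jx mx szx]]] := part_of_system hJ.
have [zs [wz [Iz mz szz]]] := part_of_system hI.
rewrite -szx in chP.
have [||ys Iy szy] := exchange hN hloc chP _ mx mz _.
- by rewrite szx szz.
- by rewrite -Jx -Iz.
have Ixy : submodule_set I = lin [set: R^o] [set 0] (catrev (xs ++ ys) [::]).
  rewrite Iz -Iy; apply: eq_lin => //; first exact: subm_zero.
  by move=> x; rewrite catrevE cats0 mem_rev.
have mxy : lin [set: R^o] [set 0] (xs ++ ys ++ wz) = m.
  by rewrite catA lin_cat Iy -lin_cat.
have szxy : size (xs ++ ys ++ wz) = size (xs ++ wx).
  by rewrite szx -szz catA [LHS]size_cat szy -size_cat.
rewrite -szxy in chP.
(* The combined list x, y, w generates m and is as long as the chain, so all its partial ideals are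
   prime. *)
have [|_ prs] := primeseq_chain hN hloc (@subm_zero R R^o) mxy _ chP.
  by move=> _ ->; case: (proj1 chP 0%N isT) => -[].
move=> i E; apply: (@sub_finite_set _ _ [set submodule_set I]); last exact: finite_set1.
apply: (Ass_local_cohomology Ixy) => a Ia.
apply: (regseq_cocycles_parts E hN Jx prs).
by rewrite Iy -Iz.
Qed.
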